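(* Let $\Gamma$ be a countable group and let $\alpha\colon \Gamma \curvearrowright X$ be an action by homeomorphisms on a compact, metrizable, $0$-dimensional space $X$. The following are equivalent: (i) the topological full group $[\![\alpha]\!]$ admits a dense locally finite subgroup; (ii) $[\![\alpha]\!]$ admits a dense ample subgroup; (iii) the clopen type semigroup $T(\alpha)$ is unperforated and cancellative.
   Context: Clopen type semigroup: let $Y = X\times\mathbb N$ (with $\mathbb N=\{0,1,2,\dots\}$), and let $\tilde\Gamma=\Gamma\times\mathfrak S$, where $\mathfrak S$ is the permutation group of $\mathbb N$, act on $Y$ by $(\gamma,\sigma)(x,n)=(\alpha(\gamma)x,\sigma(n))$. A clopen $A\subseteq Y$ is bounded if $A\cap(X\times\{n\})=\emptyset$ for all large $n$. Two bounded clopen sets $A,B$ are equidecomposable if there are clopen $A_1,\dots,A_n$ and $\tilde\gamma_1,\dots,\tilde\gamma_n\in\tilde\Gamma$ with $A=\bigsqcup_i A_i$ and $B=\bigsqcup_i\tilde\gamma_iA_i$. $T(\alpha)$ is the set of equivalence classes $[A]$ of bounded clopen sets, with $[A]+[B]=[A'\sqcup B']$ for disjoint representatives $A'\in[A]$, $B'\in[B]$; it is a commutative monoid with $0=[\emptyset]$. Write $a\le b$ iff $b=a+c$ for some $c\in T(\alpha)$. $T(\alpha)$ is unperforated if $na\le nb\Rightarrow a\le b$ for all $a,b$ and all integers $n\ge1$; cancellative if $a+b=a+c\Rightarrow b=c$. $\mathrm{Homeo}(X)$ carries the topology in which a basis of neighbourhoods of the identity is given by the subgroups $\{g: gA=A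 \text{ for all } A\in\mathcal A\}$, $\mathcal A$ ranging over finite clopen partitions of $X$; subgroups carry the induced topology. The topological full group $[\![\alpha]\!]$ is the group of homeomorphisms $g$ of $X$ for which there exist a clopen partition $X=\bigsqcup_{i=1}^nA_i$ and $\gamma_1,\dots,\gamma_n\in\Gamma$ with $g(x)=\alpha(\gamma_i)(x)$ for $x\in A_i$. A subgroup $G\le \mathrm{Homeo}(X)$ is an ample group if it is countable, locally finite, full (every homeomorphism $h$ for which there exist a clopen partition $X=\bigsqcup A_i$ and $g_i\in G$ with $h=g_i$ on $A_i$ belongs to $G$), and $\{x: g(x)=x\}$ is clopen for each $g\in G$. *)

(* Defs.v *)
From HB Require Import structures.
From mathcomp Require Import all_boot monoid.
From mathcomp Require Import boolp classical_sets cardinality reals topology.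

Set Implicit Arguments.
Unset Strict Implicit.
Unset Printing Implicit Defensive.

Local Open Scope classical_set_scope.

Definition is_action {G : groupType} {X : topologicalType} (alpha : G -> X -> X) :=
  [/\ forall g, continuous (alpha g),
      alpha 1%g = id &
      forall g h, alpha (g * h)%g = alpha g \o alpha h].

Definition homeo {X : topologicalType} (f : X -> X) :=
  continuous f /\ exists g : X -> X, [/\ continuous g, cancel f g & cancel g f].

(** A finite clopen partition of X indexed by 'I_n (empty pieces allowed). *)
Definition clopen_partition {X : topologicalType} (n : nat) (A : 'I_n -> set X) :=
  [/\ forall i, clopen (A i),
      forall i j, i != j -> A i `&` A j = set0 &
      forall x, exists i, A i x].

Definition full_group {G : groupType} {X : topologicalType} (alpha : G -> X -> X)
  : set (X -> X) :=
  [set g | homeo g /\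
     exists n (A : 'I_n -> set X) (gam : 'I_n -> G),
       clopen_partition A /\ forall i x, A i x -> g x = alpha (gam i) x].

Definition is_subgroup {X : topologicalType} (H : set (X -> X)) :=
  [/\ H `<=` homeo, H id,
      forall f g, H f -> H g -> H (f \o g) &
      forall f, H f -> exists f', [/\ H f', cancel f f' & cancel f' f]].

Definition gen_subgroup {X : topologicalType} (S : set (X -> X)) : set (X -> X) :=
  [set f | forall K, is_subgroup K -> S `<=` K -> K f].

Definition locally_finite {X : topologicalType} (H : set (X -> X)) :=
  is_subgroup H /\
  forall F, finite_set F -> F `<=` H -> finite_set (gen_subgroup F).

Definition full {X : topologicalType} (H : set (X -> X)) :=
  forall h, homeo h ->
    (exists n (A : 'I_n -> set X) (g : 'I_n -> X -> X),
       [/\ clopen_partition A, forall i, H (g i) & forall i x, A i x -> h x = g i x]) ->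
    H h.

Definition ample {X : topologicalType} (H : set (X -> X)) :=
  [/\ is_subgroup H, countable H, locally_finite H, full H &
      forall g, H g -> clopen [set x | g x = x]].

(** H is dense in G for the topology on Homeo(X) whose neighbourhood basis of
    the identity is {u | u A = A for all A in a finite clopen partition};
    the basic neighbourhoods of g are g U_A = {h | h A = g A for A in the partition}. *)
Definition dense_in {X : topologicalType} (H G : set (X -> X)) :=
  forall g, G g -> forall n (A : 'I_n -> set X), clopen_partition A ->
    exists h, H h /\ forall i, h @` A i = g @` A i.

Definition bclopen {X : topologicalType} (A : set (X * nat)) :=
  (forall n, clopen [set x | A (x, n)]) /\
  exists N, forall x n, A (x, n) -> (n < N)%N.

Definition tact {G : groupType} {X : topologicalType} (alpha : G -> X -> X)
  (g : G) (s : nat -> nat) (y : X * nat) : X * nat :=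
  (alpha g y.1, s y.2).

Definition equidec {G : groupType} {X : topologicalType} (alpha : G -> X -> X)
  (A B : set (X * nat)) :=
  exists n (P : 'I_n -> set (X * nat)) (gam : 'I_n -> G) (sig : 'I_n -> nat -> nat),
    [/\ forall i, bclopen (P i),
        forall i, bijective (sig i),
        forall i j, i != j -> P i `&` P j = set0 &
        forall y, A y <-> exists i, P i y] /\
    [/\ forall i j, i != j ->
          tact alpha (gam i) (sig i) @` P i `&` tact alpha (gam j) (sig j) @` P j = set0 &
        forall y, B y <-> exists i, (tact alpha (gam i) (sig i) @` P i) y].

(** [S] = sum of the classes [A] for A in L (via disjoint representatives). *)
Definition tsum {G : groupType} {X : topologicalType} (alpha : G -> X -> X)
  (L : seq (set (X * nat))) (S : set (X * nat)) :=
  exists L' : seq (set (X * nat)),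
    [/\ size L' = size L,
        forall i, (i < size L)%N ->
          bclopen (nth set0 L' i) /\ equidec alpha (nth set0 L i) (nth set0 L' i),
        forall i j, (i < size L)%N -> (j < size L)%N -> i != j ->
          nth set0 L' i `&` nth set0 L' j = set0 &
        equidec alpha S [set y | exists2 i, (i < size L)%N & nth set0 L' i y]].

Definition tsum_eq {G : groupType} {X : topologicalType} (alpha : G -> X -> X)
  (L1 L2 : seq (set (X * nat))) :=
  exists S, [/\ bclopen S, tsum alpha L1 S & tsum alpha L2 S].

Definition T_unperforated {G : groupType} {X : topologicalType} (alpha : G -> X -> X) :=
  forall A B, bclopen A -> bclopen B -> forall n, (0 < n)%N ->
    (exists C, bclopen C /\ tsum_eq alpha (nseq n B) (C :: nseq n A)) ->
    exists D, bclopen D /\ tsum_eq alpha [:: B] [:: A; D].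

Definition T_cancellative {G : groupType} {X : topologicalType} (alpha : G -> X -> X) :=
  forall A B C, bclopen A -> bclopen B -> bclopen C ->
    tsum_eq alpha [:: A; B] [:: A; C] -> equidec alpha B C.

(* Main.v *)
(** The type semigroup is handled through functions: a bounded clopen A in
    X x nat is replaced by the function counting its levels over each point of
    X, so that sums become pointwise sums and equidecomposability becomes the
    relation generated by [1_U ~ 1_(gamma U)].

    If H is dense and locally finite, then any relation f ~ g is witnessed by a
    finite subgroup K of H, hence the K-averages of f and g agree.  Conversely,
    matching f with g greedily along the elements of K shows that an inequality
    of K-averages implies an inequality in the semigroup.  Cancellation and
    unperforation are thus inherited from the natural numbers.

    For the converse, finite partitions of X into towers (translates of clopen
    bases) carry finite groups permuting the levels of each tower.  Given
    equidecomposable clopen C and D, the argument of Effros, Handelman and Shen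
    refines the towers until every tower has as many levels in C as in D: if K
    is the largest imbalance, attained at an excess of C-levels, unperforation
    absorbs the base of that tower into the bases of the towers with a deficit,
    and gluing the towers along this embedding produces smaller imbalances.
    Treating all pairs (C, D) in turn, the union of the finite groups is a
    dense ample group. *)

Require Import Defs.
From HB Require Import structures.
From mathcomp Require Import all_boot monoid zify.
From mathcomp Require Import boolp classical_sets cardinality reals.
From mathcomp Require Import topology.

Set Implicit Arguments.
Unset Strict Implicit.
Unset Printing Implicit Defensive.

Local Open Scope classical_set_scope.

(** * Locally constant functions and Riesz refinement *)

Definition indicator {T : Type} (A : set T) (x : T) : nat := `[< A x >].

Section LocallyConstant.
Variable X : topologicalType.

Definition locally_constant {T : Type} (f : X -> T) :=
  forall x, \forall y \near x, f y = f x.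

Lemma locally_constant_cst (T : Type) (c : T) :
  locally_constant (fun=> c).
Proof. by move=> x; exact: filterE. Qed.

Lemma locally_constant_comp (T U : Type) (F : T -> U) (f : X -> T) :
  locally_constant f -> locally_constant (fun x => F (f x)).
Proof. by move=> lf x; apply: filterS (lf x) => y ->. Qed.

Lemma locally_constant_comp2 (T U V : Type) (F : T -> U -> V) (f : X -> T)
    (g : X -> U) :
  locally_constant f -> locally_constant g ->
  locally_constant (fun x => F (f x) (g x)).
Proof. by move=> lf lg x; apply: filterS2 (lf x) (lg x) => y -> ->. Qed.

Lemma locally_constant_precomp (T : Type) (f : X -> T) (g : X -> X) :
  continuous g -> locally_constant f -> locally_constant (f \o g).
Proof. by move=> cg lf x; exact: (cg x _ (lf (g x))). Qed.

Lemma locally_constant_ffun (I : finType) (T : Type) (f : I -> X -> T) :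
  (forall i, locally_constant (f i)) ->
  locally_constant (fun x => [ffun i => f i x]).
Proof.
move=> lf x.
have h : \forall y \near x, forall i, f i y = f i x.
  by apply: filter_forall => i; exact: lf.
by apply: filterS h => y e; apply/ffunP => i; rewrite !ffunE e.
Qed.

Lemma locally_constant_sum (I : Type) (r : seq I) (P : pred I)
    (f : I -> X -> nat) :
  (forall i, locally_constant (f i)) ->
  locally_constant (fun x => \sum_(i <- r | P i) f i x).
Proof.
move=> lf; elim: r => [|a r ih] x.
  by apply: filterE => y; rewrite !big_nil.
by apply: filterS2 (lf a x) (ih x) => y e1 e2; rewrite !big_cons e1 e2.
Qed.

Lemma clopen_preimage (T : Type) (f : X -> T) (P : set T) :
  locally_constant f -> clopen [set x | P (f x)].
Proof.
move=> lf.
have op (Q : set T) : open [set x | Q (f x)].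
  by rewrite openE => x Qx; apply: filterS (lf x) => y /= ->.
split; first exact: op.
rewrite -[X in closed X]setCK; apply: open_closedC.
exact: (op (~` P)).
Qed.

Lemma clopen_locally_constant (A : set X) :
  clopen A -> locally_constant (fun x => `[< A x >]).
Proof.
move=> [oA cA] x; have [Ax|nAx] := pselect (A x).
  have : nbhs x A by exact: open_nbhs_nbhs.
  by apply: filterS => y Ay; apply/asboolP/asboolP.
have : nbhs x (~` A) by apply: open_nbhs_nbhs; split => //; exact: closed_openC.
by apply: filterS => y nAy; rewrite !asboolF.
Qed.

Lemma indicator_locally_constant (A : set X) :
  clopen A -> locally_constant (indicator A).
Proof. by move=> /clopen_locally_constant; exact: locally_constant_comp. Qed.

End LocallyConstant.

Lemma indicatorT {T : Type} (A : set T) x : A x -> indicator A x = 1.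
Proof. by move=> Ax; rewrite /indicator asboolT. Qed.

Lemma indicatorF {T : Type} (A : set T) x : ~ A x -> indicator A x = 0.
Proof. by move=> Ax; rewrite /indicator asboolF. Qed.

Lemma indicator_le1 {T : Type} (A : set T) x : indicator A x <= 1.
Proof. exact: leq_b1. Qed.

Lemma indicator_gt0 {T : Type} (A : set T) x : 0 < indicator A x -> A x.
Proof. by rewrite /indicator lt0b => /asboolP. Qed.

Lemma eq_indicator {T U : Type} (A : set T) (B : set U) x y :
  (A x <-> B y) -> indicator A x = indicator B y.
Proof. by move=> e; rewrite /indicator; congr nat_of_bool; apply: asbool_equiv_eq. Qed.

Lemma sum_nat_eq1P (I : finType) (F : I -> bool) :
  \sum_i F i = 1 -> exists i, forall j, F j = (j == i).
Proof.
move=> e; have [i Fi|F0] := pickP F; last first.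
  by move: e; rewrite big1 // => i _; rewrite F0.
exists i => j; have [->//|ji] := eqVneq.
move: e; rewrite (bigD1 i) //= (bigD1 j) //= Fi; case: (F j) => //; lia.
Qed.

Lemma sum_nat_eq1 (I : finType) (F : I -> bool) i :
  (forall j, F j = (j == i)) -> \sum_j F j = 1.
Proof.
move=> e; rewrite (bigD1 i) //= e eqxx big1 // => j /negbTE ji.
by rewrite e ji.
Qed.

Section Riesz.

(* The n-th element of A is matched with the n-th element of B. *)
Definition matching {I J : finType} (A : {set I}) (B : {set J}) i j :=
  [&& i \in A, j \in B & index i (enum A) == index j (enum B)].

Lemma sum_matching (I J : finType) (A : {set I}) (B : {set J}) i :
  #|A| <= #|B| -> \sum_j matching A B i j = (i \in A).
Proof.
move=> AB; rewrite /matching; case: (boolP (i \in A)) => iA /=; last first.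
  by rewrite big1.
have li : index i (enum A) < #|B|.
  by apply: leq_trans AB; rewrite cardE index_mem mem_enum.
have [j0 _] : exists j, j \in B.
  by apply/set0Pn; rewrite -card_gt0; exact: leq_ltn_trans li.
pose j1 := nth j0 (enum B) (index i (enum A)).
apply: (@sum_nat_eq1 _ _ j1) => j.
apply/andP/eqP => [[jB /eqP e]|->].
  by rewrite /j1 e nth_index // mem_enum.
rewrite cardE in li.
by rewrite -mem_enum mem_nth // index_uniq // enum_uniq.
Qed.

Lemma matchingC (I J : finType) (A : {set I}) (B : {set J}) i j :
  matching A B i j = matching B A j i.
Proof. by rewrite /matching eq_sym andbCA. Qed.

Lemma sum_matching_le (I J : finType) (A : {set I}) (B : {set J}) j :
  \sum_i matching A B i j <= (j \in B).
Proof.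
rewrite /matching; case: (boolP (j \in B)) => jB; last first.
  by rewrite big1 // => i _; rewrite andbF.
have [i /andP[iA e]|F0] := pickP (fun i => matching A B i j); last first.
  rewrite big1 // => i _; move: (F0 i); rewrite /matching jB /= => -> //.
case/andP: e => _ /eqP e.
rewrite (@sum_nat_eq1 _ _ i) // => i' /=.
apply/andP/eqP => [[iA' /eqP e']|->]; last by rewrite e.
rewrite -[i'](nth_index i (s := enum A)) ?mem_enum //.
by rewrite e' -e nth_index ?mem_enum.
Qed.

Variable X : topologicalType.

(** The inequality form serves to embed one family into another. With equal counts the matching also
    exhausts the [Q j], which is the common refinement behind transitivity of [fequidec]. *)
Lemma Riesz_refinement (I J : finType) (P : I -> set X) (Q : J -> set X) :
  (forall i, clopen (P i)) -> (forall j, clopen (Q j)) ->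
  (forall x, \sum_i indicator (P i) x <= \sum_j indicator (Q j) x) ->
  exists B : I -> J -> set X,
    [/\ forall i j, clopen (B i j),
        forall i x, indicator (P i) x = \sum_j indicator (B i j) x,
        forall j x, \sum_i indicator (B i j) x <= indicator (Q j) x &
        (forall x, \sum_i indicator (P i) x = \sum_j indicator (Q j) x) ->
        forall j x, indicator (Q j) x = \sum_i indicator (B i j) x].
Proof.
move=> cP cQ PQ.
(* The pieces are cut out by a matching of the sets of indices of the P i and
   of the Q j containing x, which are locally constant functions of x. *)
pose p x := [set i | `[< P i x >]]%SET; pose q x := [set j | `[< Q j x >]]%SET.
have cardp x : #|p x| = \sum_i indicator (P i) x.
  rewrite -sum1_card big_mkcond; apply: eq_bigr => i _.
  by rewrite inE /indicator; case: asbool.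
have cardq x : #|q x| = \sum_j indicator (Q j) x.
  rewrite -sum1_card big_mkcond; apply: eq_bigr => i _.
  by rewrite inE /indicator; case: asbool.
have lp : locally_constant p.
  have := locally_constant_comp (fun f : {ffun I -> bool} => [set i | f i]%SET)
    (locally_constant_ffun (fun i => clopen_locally_constant (cP i))).
  by move=> h x; apply: filterS (h x) => y /setP e; apply/setP => i;
    have := e i; rewrite !inE !ffunE.
have lq : locally_constant q.
  have := locally_constant_comp (fun f : {ffun J -> bool} => [set i | f i]%SET)
    (locally_constant_ffun (fun i => clopen_locally_constant (cQ i))).
  by move=> h x; apply: filterS (h x) => y /setP e; apply/setP => i;
    have := e i; rewrite !inE !ffunE.
pose B i j : set X := [set x | matching (p x) (q x) i j].
have indB i j x : indicator (B i j) x = matching (p x) (q x) i j.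
  by rewrite /indicator /B /=; congr nat_of_bool; exact: asboolb.
exists B; split.
- move=> i j; apply: (@clopen_preimage _ _ _ (fun b => is_true b)).
  exact: (locally_constant_comp2 (fun a b => matching a b i j) lp lq).
- move=> i x; under eq_bigr do rewrite indB.
  by rewrite sum_matching ?cardp ?cardq ?PQ // inE.
- move=> j x; under eq_bigr do rewrite indB.
  by apply: leq_trans (sum_matching_le _ _ _) _; rewrite inE.
- move=> e j x; under eq_bigr do rewrite indB matchingC.
  by rewrite sum_matching ?cardp ?cardq ?e // inE.
Qed.

End Riesz.

(** Applied pointwise, this decomposes a bounded function into the indicators of its superlevel
    sets. *)
Lemma layer_cake (m N : nat) : m <= N -> m = \sum_(k < N) (k < m).
Proof.
elim: N m => [|N ih] m; first by rewrite big_ord0 leqn0 => /eqP.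
rewrite big_ord_recr /= => mN.
have [Nm|mN'] := ltnP N m; last by rewrite addn0; exact: ih.
have -> : m = N.+1 by lia.
rewrite (eq_bigr (fun=> 1)) ?sum1_card ?card_ord ?addn1 // => i _.
by rewrite (leq_trans (ltn_ord i)).
Qed.

(** * Clopen partitions, gluing of homeomorphisms, bounded locally constant functions *)

Section Partition.
Variable X : topologicalType.

(** Disjointness and covering are encoded together in one sum of indicators, so that partitions can
    be handled by rearranging sums. *)
Definition fin_partition (I : finType) (A : I -> set X) :=
  (forall i, clopen (A i)) /\ forall x, \sum_i indicator (A i) x = 1.

Lemma fin_partition_ex (I : finType) (A : I -> set X) x :
  fin_partition A -> exists i, forall j, A j x <-> j = i.
Proof.
move=> [_ /(_ x) /sum_nat_eq1P[i hi]]; exists i => j.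
by split=> [Aj|->]; [apply/eqP; rewrite -hi; apply/asboolP
                    |apply/asboolP; rewrite hi].
Qed.

Lemma fin_partition_uniq (I : finType) (A : I -> set X) x i j :
  fin_partition A -> A i x -> A j x -> i = j.
Proof. by move=> /(fin_partition_ex x)[k hk] /hk -> /hk ->. Qed.

Lemma fin_partitionI (I : finType) (A : I -> set X) :
  (forall i, clopen (A i)) ->
  (forall x, exists i, forall j, A j x <-> j = i) -> fin_partition A.
Proof.
move=> cA h; split=> // x; have [i hi] := h x.
apply: (@sum_nat_eq1 _ _ i) => j; apply/asboolP/eqP => /hi //.
Qed.

Lemma clopen_partitionP (n : nat) (A : 'I_n -> set X) :
  clopen_partition A <-> fin_partition A.
Proof.
split=> [[cA dA eA]|pA].
  apply: fin_partitionI => // x; have [i Ai] := eA x; exists i => j.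
  split=> [Aj|->//]; apply/eqP/negPn/negP => /dA dij.
  by have : (A j `&` A i) x by []; rewrite dij.
split; first exact: pA.1.
- move=> i j ij; rewrite -subset0 => x [Ai Aj].
  by move: ij; rewrite (fin_partition_uniq pA Ai Aj) eqxx.
- by move=> x; have [i hi] := fin_partition_ex x pA; exists i; apply/hi.
Qed.

Lemma fin_partition_index (I : finType) (A : I -> set X) :
  fin_partition A -> exists k : X -> I,
    locally_constant k /\ forall x i, A i x <-> i = k x.
Proof.
move=> pA; have /choice[k hk] := fun x => fin_partition_ex x pA.
exists k; split=> // x.
have := clopen_locally_constant (pA.1 (k x)) x.
apply: filterS => y e; apply/esym/hk/asboolP; rewrite e.
by apply/asboolP/hk.
Qed.

Lemma fin_partition_enum (I : finType) (A : I -> set X) :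
  fin_partition A -> fin_partition (fun i : 'I_#|I| => A (enum_val i)).
Proof.
move=> [cA sA]; split=> // x.
by rewrite -[RHS](sA x) [RHS](reindex _ (onW_bij _ (@enum_val_bij I))).
Qed.

Lemma continuous_piecewise (I : finType) (A : I -> set X) (f : I -> X -> X)
    (h : X -> X) :
  fin_partition A -> (forall i, continuous (f i)) ->
  (forall i x, A i x -> h x = f i x) -> continuous h.
Proof.
move=> pA cf hf x; have [k [lk Ak]] := fin_partition_index pA.
have hk y : h y = f (k y) y by apply: hf; apply/Ak.
rewrite /continuous_at hk; apply: cvg_trans (cf (k x) x).
apply: near_eq_cvg; apply: filterS (lk x) => y /= e.
by rewrite hk e.
Qed.

(** The last hypothesis says that the images of the [A i] under [f i] again partition [X]; on these
    images the maps [f' i] glue to the inverse. *)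
Lemma homeo_glue (I : finType) (A : I -> set X) (f f' : I -> X -> X) :
  fin_partition A ->
  (forall i, continuous (f i)) -> (forall i, continuous (f' i)) ->
  (forall i, cancel (f i) (f' i)) -> (forall i, cancel (f' i) (f i)) ->
  (forall x, \sum_i indicator (A i) (f' i x) = 1) ->
  exists h, homeo h /\ forall i x, A i x -> h x = f i x.
Proof.
move=> pA cf cf' fK f'K sA.
have pA' : fin_partition (fun i => [set x | A i (f' i x)]).
  split=> // i; exact: (preimage_clopen (pA.1 i) (cf' i)).
have [k [_ Ak]] := fin_partition_index pA.
have [k' [_ Ak']] := fin_partition_index pA'.
pose h x := f (k x) x; pose h' x := f' (k' x) x.
have hf i x : A i x -> h x = f i x by move=> /Ak ->.
have hf' i x : A i (f' i x) -> h' x = f' i x.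
  by move=> Ai; rewrite /h'; have /Ak' <- : [set x | A i (f' i x)] x by [].
exists h; split=> //; split; first exact: continuous_piecewise pA cf hf.
exists h'; split; first exact: continuous_piecewise pA' cf' hf'.
- move=> x; have Akx : A (k x) x by apply/Ak.
  by rewrite (hf (k x)) // (hf' (k x)) ?fK.
- move=> x; have Akx : A (k' x) (f' (k' x) x).
    by have /Ak' : k' x = k' x by [].
  by rewrite (hf' (k' x)) // (hf (k' x)) ?f'K.
Qed.

(** These are exactly the level counts of bounded clopen sets, by [bounded_lc_height] and
    [height_undergraph]. *)
Definition bounded_lc (f : X -> nat) :=
  locally_constant f /\ exists N, forall x, f x <= N.

Lemma bounded_lc_cst c : bounded_lc (fun=> c).
Proof. by split; [exact: locally_constant_cst|exists c]. Qed.

Lemma bounded_lc_indicator (A : set X) : clopen A -> bounded_lc (indicator A).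
Proof.
move=> cA; split; first exact: indicator_locally_constant.
by exists 1 => x; exact: indicator_le1.
Qed.

Lemma bounded_lcD f g :
  bounded_lc f -> bounded_lc g -> bounded_lc (fun x => f x + g x).
Proof.
move=> [lf [M fM]] [lg [N gN]]; split; first exact: locally_constant_comp2.
by exists (M + N) => x; exact: leq_add.
Qed.

Lemma bounded_lc_sum (I : Type) (r : seq I) (P : pred I) (f : I -> X -> nat) :
  (forall i, bounded_lc (f i)) ->
  bounded_lc (fun x => \sum_(i <- r | P i) f i x).
Proof.
move=> bf; split; first by apply: locally_constant_sum => i; exact: (bf i).1.
have /choice[N fN] := fun i => (bf i).2.
by exists (\sum_(i <- r | P i) N i) => x; apply: leq_sum => i _.
Qed.

Lemma bounded_lcM c f : bounded_lc f -> bounded_lc (fun x => c * f x).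
Proof.
move=> [lf [N fN]]; split; first exact: locally_constant_comp.
by exists (c * N) => x; rewrite leq_mul2l fN orbT.
Qed.

Lemma bounded_lc_le f g :
  locally_constant f -> bounded_lc g -> (forall x, f x <= g x) -> bounded_lc f.
Proof.
move=> lf [_ [N gN]] fg; split=> //; exists N => x.
exact: leq_trans (fg x) (gN x).
Qed.

Lemma bounded_lc_precomp f (k : X -> X) :
  continuous k -> bounded_lc f -> bounded_lc (f \o k).
Proof.
by move=> ck [lf [N fN]]; split; [exact: locally_constant_precomp|exists N => x /=].
Qed.

End Partition.

(** * Equidecomposability of functions *)

Section Equidecomposable.
Variables (Gam : groupType) (X : topologicalType) (alpha : Gam -> X -> X).
Hypothesis actA : is_action alpha.

Lemma act_continuous g : continuous (alpha g).
Proof. by case: actA. Qed.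

Lemma actM g h x : alpha (g * h)%g x = alpha g (alpha h x).
Proof. by case: actA => _ _ ->. Qed.

Lemma act1 x : alpha 1%g x = x.
Proof. by case: actA => _ -> _. Qed.

Lemma actK g : cancel (alpha g) (alpha g^-1%g).
Proof. by move=> x; rewrite -actM mulVg act1. Qed.

Lemma actVK g : cancel (alpha g^-1%g) (alpha g).
Proof. by move=> x; rewrite -actM mulgV act1. Qed.

Lemma clopen_act g (A : set X) : clopen A -> clopen [set x | A (alpha g x)].
Proof. by move=> cA; exact: (preimage_clopen cA (@act_continuous g)). Qed.

Lemma homeo_act g : homeo (alpha g).
Proof.
split; first exact: act_continuous.
by exists (alpha g^-1%g); split; [exact: act_continuous|exact: actK|exact: actVK].
Qed.

Lemma full_groupI (I : finType) (A : I -> set X) (c : I -> Gam) h :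
  homeo h -> fin_partition A ->
  (forall i x, A i x -> h x = alpha (c i) x) -> full_group alpha h.
Proof.
move=> hh pA hA; split=> //; exists #|I|, (A \o enum_val), (c \o enum_val).
split; first exact/clopen_partitionP/fin_partition_enum.
by move=> i x; exact: hA.
Qed.

Lemma full_group_act g : full_group alpha (alpha g).
Proof.
apply: (@full_groupI unit (fun=> setT) (fun=> g)) => //; first exact: homeo_act.
split=> [_|x]; first exact: clopenT.
by rewrite big_const card_unit /= indicatorT.
Qed.

(** The summand [indicator (U i) (alpha (c i)^-1 x)] is the indicator of the translate of [U i] by
    [c i]. *)
Definition fequidec (f g : X -> nat) :=
  exists (I : finType) (U : I -> set X) (c : I -> Gam),
    [/\ forall i, clopen (U i),
        forall x, f x = \sum_i indicator (U i) x &
        forall x, g x = \sum_i indicator (U i) (alpha (c i)^-1%g x)].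

Lemma fequidec_bounded f g : fequidec f g -> bounded_lc f.
Proof.
move=> [I [U [c [cU fU _]]]]; rewrite (funext fU).
by apply: bounded_lc_sum => i; exact: bounded_lc_indicator.
Qed.

(** Cut [f] into its superlevel sets intersected with the pieces of [k]; on each of these [k] acts
    as a single group element, and [f \o k'] is the push-forward of [f]. *)
Lemma fequidec_piecewise k k' (f : X -> nat) :
  full_group alpha k -> cancel k k' -> cancel k' k -> bounded_lc f ->
  fequidec f (f \o k').
Proof.
move=> [_ [n [A [c [/clopen_partitionP pA kA]]]]] kK k'K [lf [N fN]].
pose U (p : 'I_n * 'I_N) : set X := A p.1 `&` [set x | p.2 < f x].
have indU p x : indicator (U p) x = indicator (A p.1) x * (p.2 < f x).
  rewrite /indicator mulnb; congr nat_of_bool; rewrite /U /setI /=.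
  by rewrite asbool_and asboolb.
have sumU x : f x = \sum_p indicator (U p) x.
  under eq_bigr do rewrite indU.
  rewrite -(pair_big xpredT xpredT (fun i (j : 'I_N) =>
    indicator (A i) x * (j < f x))) /=.
  under eq_bigr do rewrite -big_distrr /= -layer_cake //.
  by rewrite -big_distrl /= pA.2 mul1n.
exists ('I_n * 'I_N)%type, U, (c \o fst); split=> //.
- move=> p; apply: clopenI; first exact: pA.1.
  exact: (@clopen_preimage _ _ f (fun m => p.2 < m)).
- move=> x; rewrite /= sumU.
  apply: eq_bigr => p _; apply: eq_indicator; split=> [[Ap fp]|[Ap fp]].
    by rewrite /U -(k'K x) (kA _ _ Ap) actK.
  have e : k' x = alpha (c p.1)^-1%g x.
    by rewrite -{1}(actVK (c p.1) x) -(kA _ _ Ap) kK.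
  by rewrite /U e.
Qed.

Lemma fequidec_refl f : bounded_lc f -> fequidec f f.
Proof.
move=> bf; have e1 : alpha 1%g = id by apply/funext => x; exact: act1.
have := full_group_act 1%g; rewrite e1 => fid.
exact: (fequidec_piecewise (k' := id) fid).
Qed.

Lemma fequidec_sym f g : fequidec f g -> fequidec g f.
Proof.
move=> [I [U [c [cU fU gU]]]].
exists I, (fun i => [set x | U i (alpha (c i)^-1%g x)]), (fun i => (c i)^-1%g).
split=> [i|//|x]; first exact: clopen_act.
rewrite fU; apply: eq_bigr => i _; apply: eq_indicator => /=.
by rewrite invgK actK.
Qed.

(** The translated pieces [U' i] and the pieces [V j] are two decompositions of [g]. Their common
    refinement [B i j] is pulled back by [c i] and then moved by [d j * c i]. *)
Lemma fequidec_trans f g h : fequidec f g -> fequidec g h -> fequidec f h.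
Proof.
move=> [I [U [c [cU fU gU]]]] [J [V [d [cV gV hV]]]].
pose U' i := [set x | U i (alpha (c i)^-1%g x)].
have cU' i : clopen (U' i) by exact: clopen_act.
have e x : \sum_i indicator (U' i) x = \sum_j indicator (V j) x.
  by rewrite -gV gU.
have [|B [cB BU _ /(_ e) BV]] := @Riesz_refinement _ _ _ U' V cU' cV.
  by move=> x; rewrite e.
exists (I * J)%type, (fun p => [set x | B p.1 p.2 (alpha (c p.1) x)]).
exists (fun p => d p.2 * c p.1)%g; split.
- by move=> p; exact: clopen_act.
- move=> x; rewrite fU -(pair_big xpredT xpredT (fun i j =>
    indicator [set x | B i j (alpha (c i) x)] x)) /=.
  apply: eq_bigr => i _; transitivity (indicator (U' i) (alpha (c i) x)).
    by apply: eq_indicator; rewrite /U' /= actK.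
  by rewrite BU.
- move=> x; rewrite hV -(pair_big xpredT xpredT (fun i j =>
    indicator [set x | B i j (alpha (c i) x)] (alpha (d j * c i)^-1%g x))) /=.
  rewrite exchange_big /=; apply: eq_bigr => j _.
  rewrite BV; apply: eq_bigr => i _; apply: eq_indicator => /=.
  by rewrite invgM actM actVK.
Qed.

Lemma fequidecD f g f' g' : fequidec f g -> fequidec f' g' ->
  fequidec (fun x => f x + f' x) (fun x => g x + g' x).
Proof.
move=> [I [U [c [cU fU gU]]]] [J [V [d [cV fV gV]]]].
exists (I + J)%type, (fun k => match k with inl i => U i | inr j => V j end).
exists (fun k => match k with inl i => c i | inr j => d j end).
by split=> [[]//|x|x]; rewrite big_sumType /= ?fU ?gU ?fV ?gV.
Qed.

Lemma fequidec_sum (I : Type) (r : seq I) (P : pred I) (f g : I -> X -> nat) :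
  (forall i, fequidec (f i) (g i)) ->
  fequidec (fun x => \sum_(i <- r | P i) f i x)
           (fun x => \sum_(i <- r | P i) g i x).
Proof.
move=> fg; elim: r => [|a r ih].
  rewrite (_ : (fun x => _) = (fun=> 0)); last by apply/funext=> x; rewrite big_nil.
  rewrite [X in fequidec _ X](_ : _ = (fun=> 0)); last by apply/funext=> x; rewrite big_nil.
  exact/fequidec_refl/bounded_lc_cst.
under eq_fun do rewrite big_cons.
under [X in fequidec _ X]eq_fun do rewrite big_cons.
by case: (P a) => //; exact: fequidecD.
Qed.

Lemma fequidec_act f g : bounded_lc f -> fequidec f (f \o alpha g^-1%g).
Proof.
by move=> bf; apply: fequidec_piecewise (full_group_act g) _ _ bf;
  [exact: actK|exact: actVK].
Qed.

End Equidecomposable.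

(** * The type semigroup through level-counting functions *)

Lemma indicator_sumI (T : Type) (I : finType) (A : set T) (B : I -> set T) y :
  (A y <-> exists i, B i y) -> (forall i j, B i y -> B j y -> i = j) ->
  indicator A y = \sum_i indicator (B i) y.
Proof.
move=> AB uB; have [Ay|nA] := pselect (A y); last first.
  rewrite indicatorF // big1 // => i _; apply: indicatorF => Bi.
  by apply/nA/AB; exists i.
have /AB[i Bi] := Ay; rewrite indicatorT //.
apply/esym/(@sum_nat_eq1 _ _ i) => j.
by apply/asboolP/eqP => [Bj|->//]; exact: uB.
Qed.

Lemma indicator_sumE (T : Type) (I : finType) (A : set T) (B : I -> set T) y :
  indicator A y = \sum_i indicator (B i) y ->
  [/\ forall i, B i y -> A y, A y -> exists i, B i y &
      forall i j, B i y -> B j y -> i = j].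
Proof.
move=> e; split=> [i Bi|Ay|i j Bi Bj].
- by apply: indicator_gt0; rewrite e (bigD1 i) //= indicatorT.
- move: e; rewrite indicatorT // => /esym/sum_nat_eq1P[i hi].
  by exists i; apply/asboolP; rewrite hi.
- apply/eqP/negPn/negP => ij.
  have := indicator_le1 A y; rewrite e (bigD1 i) //= (bigD1 j) 1?eq_sym //=.
  by rewrite !indicatorT //; lia.
Qed.

(** Both sides count the same finite set, reindexed by a permutation. This makes level counts
    independent of the chosen bound and invariant under permutations of the levels. *)
Lemma sum_bijective (F : nat -> bool) (s t : nat -> nat) N M :
  cancel s t -> cancel t s ->
  (forall n, F n -> n < N) -> (forall m, F (t m) -> m < M) ->
  \sum_(m < M) F (t m) = \sum_(n < N) F n.
Proof.
move=> sK tK FN FM.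
rewrite -(big_mkord xpredT (fun m => F (t m) : nat)) -(big_mkord xpredT (fun n => F n : nat)).
rewrite -!big_mkcond /= -!(big_filter _ F) -(big_filter _ (fun m => F (t m))).
rewrite !sum1_size -(size_map t); apply/perm_size/uniq_perm.
- by rewrite map_inj_uniq ?filter_uniq ?iota_uniq //; exact: can_inj tK.
- by rewrite filter_uniq ?iota_uniq.
- move=> n; rewrite mem_filter mem_index_iota /=.
  apply/mapP/idP => [[m]|/andP[Fn nN]].
    by rewrite mem_filter => /andP[Fm _] ->; rewrite Fm FN.
  by exists (s n); rewrite ?sK // mem_filter mem_index_iota sK Fn FM ?sK.
Qed.

Lemma transposition_bijective n m :
  bijective (fun k : nat => if k == n then m else if k == m then n else k).
Proof.
exists (fun k : nat => if k == n then m else if k == m then n else k) => k /=;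
by have [->|kn] := eqVneq k n; [have [->|mn] := eqVneq m n; rewrite ?eqxx //
  |have [->|km] := eqVneq k m; rewrite ?eqxx ?(negbTE kn) ?(negbTE km)].
Qed.

Section Levels.
Variable X : topologicalType.

Definition level_bound (A : set (X * nat)) N := forall x n, A (x, n) -> n < N.

(** [xget] chooses some bound on the levels of [A], with default 0 for an unbounded [A]; by
    [heightE] every bound gives the same count. *)
Definition height (A : set (X * nat)) (x : X) :=
  \sum_(n < xget 0 (level_bound A)) indicator A (x, n : nat).

Lemma heightE A N x : level_bound A N ->
  height A x = \sum_(n < N) indicator A (x, n : nat).
Proof.
move=> bN; have bx : level_bound A (xget 0 (level_bound A)).
  exact: (xgetI 0 bN).
rewrite /height /indicator.
apply: (@sum_bijective (fun n => `[< A (x, n) >]) id id) => // n /asboolP.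
  exact: bN.
exact: bx.
Qed.

Lemma bounded_lc_height (A : set (X * nat)) : bclopen A -> bounded_lc (height A).
Proof.
move=> [cA [N bN]].
have -> : height A = fun x => \sum_(n < N) indicator A (x, n : nat).
  by apply/funext => x; exact: heightE.
apply: bounded_lc_sum => n; exact: (bounded_lc_indicator (cA n)).
Qed.

Definition undergraph (f : X -> nat) : set (X * nat) := [set y | y.2 < f y.1].

Lemma bclopen_undergraph f : bounded_lc f -> bclopen (undergraph f).
Proof.
move=> [lf [N fN]]; split=> [n|].
  exact: (@clopen_preimage _ _ f (fun m => n < m)).
by exists N => x n /= h; exact: leq_trans h (fN x).
Qed.

Lemma height_undergraph f : bounded_lc f -> height (undergraph f) = f.
Proof.
move=> [lf [N fN]]; apply/funext => x; rewrite (@heightE _ N) => [|{}x n /= h].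
  rewrite [RHS](layer_cake (fN x)); apply: eq_bigr => n _.
  by rewrite /indicator /undergraph /= asboolb.
exact: leq_trans h (fN x).
Qed.

Lemma bclopen_setU (k : nat) (A : nat -> set (X * nat)) :
  (forall i, i < k -> bclopen (A i)) ->
  bclopen [set y | exists2 i, i < k & A i y].
Proof.
elim: k => [|k ih] cA.
  split=> [n|]; last by exists 0 => x n [].
  rewrite (_ : [set _ | _] = set0); first exact: clopen0.
  by rewrite -subset0 => x [].
have [cU [N bN]] := ih (fun i ik => cA i (ltnW ik)).
have [ck [M bM]] := cA k (ltnSn k).
split=> [n|].
  have := clopenU (cU n) (ck n).
  congr clopen; apply/seteqP; split=> x /=.
    by case=> [[i ik Ai]|Ak]; [exists i => //; exact: ltnW|exists k].
  by case=> i; rewrite ltnS leq_eqVlt => /orP[/eqP->|ik] Ai;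
    [right|left; exists i].
exists (N + M) => x n [i]; rewrite ltnS leq_eqVlt => /orP[/eqP->|ik] Ai.
  by have := bM _ _ Ai; lia.
have /bN : exists2 i, i < k & A i (x, n) by exists i.
lia.
Qed.

Lemma height_setU (k : nat) (A : nat -> set (X * nat)) x :
  (forall i, i < k -> bclopen (A i)) ->
  (forall i j, i < k -> j < k -> i != j -> A i `&` A j = set0) ->
  height [set y | exists2 i, i < k & A i y] x = \sum_(i < k) height (A i) x.
Proof.
move=> cA dA; have [_ [N bN]] := bclopen_setU cA.
rewrite (heightE x bN).
have -> : \sum_(i < k) height (A i) x =
    \sum_(i < k) \sum_(n < N) indicator (A i) (x, n : nat).
  apply: eq_bigr => i _; apply: heightE => z n Ai; apply: (bN z).
  by exists i.
rewrite exchange_big; apply: eq_bigr => n _.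
apply: (@indicator_sumI _ _ _ (fun i : 'I_k => A i)) => [|i j Ai Aj].
  by split=> [[i ik Ai]|[i Ai]]; [exists (Ordinal ik)|exists i].
apply/val_inj/eqP/negPn/negP => ij.
have := dA _ _ (ltn_ord i) (ltn_ord j) ij.
by move=> /seteqP[h _]; exact: (h (x, n : nat)).
Qed.

End Levels.

Section TypeSemigroup.
Variables (Gam : groupType) (X : topologicalType) (alpha : Gam -> X -> X).
Hypothesis actA : is_action alpha.

Lemma tact_image g (s t : nat -> nat) (P : set (X * nat)) z m :
  cancel s t -> cancel t s ->
  (tact alpha g s @` P) (z, m) <-> P (alpha g^-1%g z, t m).
Proof.
move=> sK tK; split=> [[[x n] Pxn [<- <-]]|P'].
  by rewrite (actK actA) sK.
by exists (alpha g^-1%g z, t m) => //; rewrite /tact /= (actVK actA) tK.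
Qed.

(** Slice each piece [P i] into its levels, each slice being moved by [c i]. The permutation [s i]
    only reorders the slices over a point, and counting forgets it. *)
Lemma equidec_height A B : bclopen A -> bclopen B ->
  equidec alpha A B -> fequidec alpha (height A) (height B).
Proof.
move=> [_ [N bN]] [_ [M bM]].
move=> [k [P [c [s [[cP bs dP AP] [dQ BQ]]]]]].
have /choice[t ht] i : exists t, cancel (s i) t /\ cancel t (s i).
  by case: (bs i) => t ? ?; exists t.
have QP i z m := tact_image (c i) (P i) z m (ht i).1 (ht i).2.
have sA y : indicator A y = \sum_i indicator (P i) y.
  apply: indicator_sumI => // i j Pi Pj; apply/eqP/negPn/negP => /dP /seteqP[h _].
  exact: (h y).
have sB z m : indicator B (z, m) =
    \sum_i indicator (P i) (alpha (c i)^-1%g z, t i m).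
  rewrite (@indicator_sumI _ _ _ (fun i => tact alpha (c i) (s i) @` P i)) //.
    by apply: eq_bigr => i _; apply: eq_indicator; exact: QP.
  move=> i j Pi Pj; apply/eqP/negPn/negP => /dQ /seteqP[h _].
  exact: (h (z, m)).
exists ('I_k * 'I_N)%type, (fun p : 'I_k * 'I_N => [set x | P p.1 (x, p.2 : nat)]).
exists (c \o fst); split.
- by move=> p; exact: (cP p.1).1.
- move=> x; rewrite (heightE _ bN) -(pair_big xpredT xpredT (fun i (n : 'I_N) =>
    indicator [set x | P i (x, n : nat)] x)) /= exchange_big.
  by apply: eq_bigr => n _; rewrite sA.
- move=> x; rewrite (heightE _ bM) -(pair_big xpredT xpredT (fun i (n : 'I_N) =>
    indicator [set x | P i (x, n : nat)] (alpha (c i)^-1%g x))) /=.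
  under eq_bigr do rewrite sB.
  rewrite exchange_big; apply: eq_bigr => i _.
  apply: (@sum_bijective (fun n => `[< P i (alpha (c i)^-1%g x, n) >])
    (s i) (t i) N M (ht i).1 (ht i).2).
    by move=> n /asboolP Pn; apply: (bN (alpha (c i)^-1%g x)); apply/AP; exists i.
  by move=> m /asboolP/QP Pm; apply: (bM x); apply/BQ; exists i.
Qed.

Lemma equidec_fin (K : finType) (P : K -> set (X * nat)) (c : K -> Gam)
    (s : K -> nat -> nat) A B :
  [/\ forall p, bclopen (P p), forall p, bijective (s p),
      forall y, indicator A y = \sum_p indicator (P p) y &
      forall y, indicator B y =
        \sum_p indicator (tact alpha (c p) (s p) @` P p) y] ->
  equidec alpha A B.
Proof.
move=> [cP bs sA sB].
exists #|K|, (P \o enum_val), (c \o enum_val), (s \o enum_val).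
have ev (Q : K -> set (X * nat)) E :
    (forall y, indicator E y = \sum_p indicator (Q p) y) ->
    (forall i j : 'I_#|K|, i != j ->
      Q (enum_val i) `&` Q (enum_val j) = set0) /\
    forall y, E y <-> exists i : 'I_#|K|, Q (enum_val i) y.
  move=> sE; split=> [i j ij|y].
    rewrite -subset0 => y [Qi Qj].
    have [_ _ /(_ _ _ Qi Qj) /enum_val_inj e] := indicator_sumE (sE y).
    by rewrite e eqxx in ij.
  have [h1 h2 _] := indicator_sumE (sE y).
  split=> [/h2[p Qp]|[i /h1//]].
  by exists (enum_rank p); rewrite enum_rankK.
have [dA AP] := ev _ _ sA; have [dB BP] := ev _ _ sB.
by split; split=> // i /=; [exact: cP|exact: bs].
Qed.

(** Refine the [U i] against the actual levels of [A], and their translates against those of [B].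
    The piece indexed by [(i, n, m)] lies in level [n] of [A] and is sent to level [m] of [B] by
    [c i] and the transposition of [n] and [m]. *)
Lemma height_equidec A B : bclopen A -> bclopen B ->
  fequidec alpha (height A) (height B) -> equidec alpha A B.
Proof.
move=> [cA [N bN]] [cB [M bM]] [I [U [c [cU hA hB]]]].
have cV i : clopen [set x | U i (alpha (c i)^-1%g x)] by exact: (clopen_act actA).
have eA x : \sum_i indicator (U i) x =
    \sum_(n < N) indicator [set x | A (x, n : nat)] x.
  by rewrite -hA (heightE _ bN).
have eB x : \sum_i indicator [set x | U i (alpha (c i)^-1%g x)] x =
    \sum_(n < M) indicator [set x | B (x, n : nat)] x.
  by transitivity (height B x); [rewrite hB|exact: heightE].
have [x|D [cD UD _ /(_ eA) AD]] := Riesz_refinement cU (fun n : 'I_N => cA n).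
  by rewrite eA.
have [x|E [cE UE _ /(_ eB) BE]] := Riesz_refinement cV (fun n : 'I_M => cB n).
  by rewrite eB.
pose P (p : I * 'I_N * 'I_M) : set (X * nat) :=
  [set y | [/\ y.2 = p.1.2 :> nat, D p.1.1 p.1.2 y.1 &
               E p.1.1 p.2 (alpha (c p.1.1) y.1)]].
pose s (p : I * 'I_N * 'I_M) (k : nat) :=
  if k == p.1.2 then p.2 : nat else if k == p.2 then p.1.2 : nat else k.
have sP p : bijective (s p) by exact: transposition_bijective.
have sE p : s p p.1.2 = p.2 by rewrite /s eqxx.
apply: (@equidec_fin _ P (fun p => c p.1.1) s); split=> //.
- move=> p; split=> [n|].
    have [->|ne] := eqVneq n (p.1.2 : nat).
      rewrite (_ : [set x | _] = D p.1.1 p.1.2 `&`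
        [set x | E p.1.1 p.2 (alpha (c p.1.1) x)]).
        by apply: clopenI; [exact: cD|exact: (clopen_act actA)].
      by apply/seteqP; split=> x /=; [case|case=> ? ?; split].
    rewrite (_ : [set x | _] = set0); first exact: clopen0.
    by rewrite -subset0 => x [/= e]; rewrite e eqxx in ne.
  by exists p.1.2.+1 => x n [/= ->].
- move=> [x k]; apply: indicator_sumI => [|[[i n] m] [[i' n'] m']].
    split=> [Axk|[[[i n] m] [/= -> Dx _]]].
      have kN := bN _ _ Axk.
      have [_ /(_ Axk)[i Di] _] := indicator_sumE (AD (Ordinal kN) x).
      have [/(_ _ Di) Ui _ _] := indicator_sumE (UD i x).
      have [_ + _] := indicator_sumE (UE i (alpha (c i) x)).
      case=> [|m Em]; first by rewrite /= (actK actA).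
      by exists (i, Ordinal kN, m).
    by have [/(_ _ Dx)] := indicator_sumE (AD n x).
  move=> [/= kn Di Ei] [/= kn' Di' Ei'].
  have e : n = n' by apply: val_inj; rewrite /= -kn.
  move: Di' Ei'; rewrite -e => Di' Ei'.
  have [_ _ /(_ _ _ Di Di') e'] := indicator_sumE (AD n x).
  move: Ei'; rewrite -e' => Ei'.
  by have [_ _ /(_ _ _ Ei Ei') ->] := indicator_sumE (UE i (alpha (c i) x)).
- have imP p z k : (tact alpha (c p.1.1) (s p) @` P p) (z, k) <->
      [/\ k = p.2, D p.1.1 p.1.2 (alpha (c p.1.1)^-1%g z) & E p.1.1 p.2 z].
    split=> [[[x n] [/= -> Dx Ex] [<- <-]]|[-> Dz Ez]].
      by split=> //; rewrite (actK actA).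
    exists (alpha (c p.1.1)^-1%g z, p.1.2 : nat); first by split=> //=; rewrite (actVK actA).
    by rewrite /tact /= (actVK actA) sE.
  move=> [z k]; apply: indicator_sumI => [|[[i n] m] [[i' n'] m']].
    split=> [Bzk|[p /imP[-> _ Ez]]].
      have kM := bM _ _ Bzk.
      have [_ /(_ Bzk)[i Ei] _] := indicator_sumE (BE (Ordinal kM) z).
      have [/(_ _ Ei) Ui _ _] := indicator_sumE (UE i z).
      have [_ /(_ Ui)[n Dn] _] := indicator_sumE (UD i (alpha (c i)^-1%g z)).
      by exists (i, n, Ordinal kM); apply/imP.
    by have [/(_ _ Ez)] := indicator_sumE (BE p.2 z).
  move=> /imP[/= km Di Ei] /imP[/= km' Di' Ei'].
  have e : m = m' by apply: val_inj; rewrite /= -km.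
  move: Di' Ei'; rewrite -e => Di' Ei'.
  have [_ _ /(_ _ _ Ei Ei') e'] := indicator_sumE (BE m z).
  move: Di'; rewrite -e' => Di'.
  by have [_ _ /(_ _ _ Di Di') ->] := indicator_sumE (UD i (alpha (c i)^-1%g z)).
Qed.

Lemma tsum_height L S : (forall A, A \in L -> bclopen A) -> bclopen S ->
  tsum alpha L S <->
  fequidec alpha (height S) (fun x => \sum_(A <- L) height A x).
Proof.
move=> cL cS.
have cLi i : i < size L -> bclopen (nth set0 L i) by move=> ?; apply/cL/mem_nth.
have sumL (F : set (X * nat) -> X -> nat) :
    (fun x => \sum_(A <- L) F A x) =
    (fun x => \sum_(i < size L) F (nth set0 L i) x).
  by apply/funext => x; rewrite (big_nth set0) big_mkord.
rewrite sumL; split.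
  move=> [L' [sL' hL' dL' SL']].
  have cL' i : i < size L -> bclopen (nth set0 L' i) by move=> /hL'[].
  have := equidec_height cS (bclopen_setU cL') SL'.
  rewrite (funext (fun x => height_setU x cL' dL')) => h.
  apply: (fequidec_trans actA h); apply: (fequidec_sum actA) => i.
  apply: (fequidec_sym actA); have [_] := hL' i (ltn_ord i).
  by apply: equidec_height; [exact: cLi|exact: cL'].
move=> h.
have [N bN] : exists N, forall i, i < size L -> level_bound (nth set0 L i) N.
  have /choice[b hb] (i : 'I_(size L)) : exists N, level_bound (nth set0 L i) N.
    by have [_] := cLi i (ltn_ord i).
  exists (\sum_i b i) => i iL x n /(hb (Ordinal iL)).
  by rewrite (bigD1 (Ordinal iL)) //=; lia.
(* The [i]-th set is shifted up into the band of the [N] levels starting at [i * N], which yields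
   disjoint representatives. *)
pose A i : set (X * nat) :=
  [set y | i * N <= y.2 /\ nth set0 L i (y.1, y.2 - i * N)].
have bA i : i < size L -> level_bound (A i) (i * N + N).
  by move=> iL x n [/= iN /(bN _ iL)]; lia.
have cA i : i < size L -> bclopen (A i).
  move=> iL; split=> [n|]; last by exists (i * N + N); exact: bA.
  have [iN|iN] := leqP (i * N) n.
    rewrite (_ : [set x | _] = [set x | nth set0 L i (x, n - i * N)]).
      exact: (cLi i iL).1.
    by apply/seteqP; split=> x /=; [case|].
  rewrite (_ : [set x | _] = set0); first exact: clopen0.
  by rewrite -subset0 => x [/=]; lia.
have hA i : i < size L -> height (A i) = height (nth set0 L i).
  move=> iL; apply/funext => x; rewrite (heightE x (bN _ iL)) (heightE x (bA _ iL)).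
  rewrite big_split_ord /= big1 ?add0n => [|j _].
    apply: eq_bigr => j _; apply: eq_indicator; rewrite /A /=.
    rewrite addKn; split=> [[]//|]; split=> //; exact: leq_addr.
  by apply: indicatorF => -[/=]; have := ltn_ord j; lia.
have dA i j : i < size L -> j < size L -> i != j -> A i `&` A j = set0.
  move=> iL jL ij; rewrite -subset0 => -[x n] [Ai Aj].
  have /= := bA i iL _ _ Ai; have /= := bA j jL _ _ Aj.
  move: Ai.1 Aj.1 => /=; move: ij; rewrite neq_ltn => /orP[] ij; nia.
exists (mkseq A (size L)); rewrite size_mkseq; split=> //.
- move=> i iL; rewrite nth_mkseq //; split; first exact: cA.
  apply: height_equidec; [exact: cLi|exact: cA|].
  by rewrite hA //; exact/(fequidec_refl actA)/bounded_lc_height/cLi.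
- by move=> i j iL jL; rewrite !nth_mkseq //; exact: dA.
- rewrite (_ : [set y | _] = [set y | exists2 i, i < size L & A i y]); last first.
    by apply/seteqP; split=> y /= -[i iL]; rewrite ?nth_mkseq // => Ai;
      exists i; rewrite ?nth_mkseq.
  apply: height_equidec => //; first exact: bclopen_setU.
  rewrite (funext (fun x => height_setU x cA dA)).
  by under [X in fequidec _ _ X]eq_fun do
    under eq_bigr => i _ do rewrite (hA i (ltn_ord i)).
Qed.

Lemma tsum_eq_height L1 L2 :
  (forall A, A \in L1 -> bclopen A) -> (forall A, A \in L2 -> bclopen A) ->
  tsum_eq alpha L1 L2 <->
  fequidec alpha (fun x => \sum_(A <- L1) height A x)
                 (fun x => \sum_(A <- L2) height A x).
Proof.
move=> c1 c2; split=> [[S [cS h1 h2]]|h].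
  apply: (fequidec_trans actA (g := height S)).
    by apply: (fequidec_sym actA); apply/tsum_height.
  exact/tsum_height.
have b1 := fequidec_bounded h.
exists (undergraph (fun x => \sum_(A <- L1) height A x)); split.
- exact: bclopen_undergraph.
- apply/tsum_height => //; first exact: bclopen_undergraph.
  by rewrite height_undergraph //; exact: (fequidec_refl actA).
- apply/tsum_height => //; first exact: bclopen_undergraph.
  by rewrite height_undergraph.
Qed.

(** * Cancellation and unperforation in terms of functions *)

Definition fcancellative := forall f g h : X -> nat,
  bounded_lc f -> bounded_lc g -> bounded_lc h ->
  fequidec alpha (fun x => f x + g x) (fun x => f x + h x) ->
  fequidec alpha g h.

(** [h] and [d] are the complements witnessing [n f <= n g] and [f <= g] in the semigroup. *)
Definition funperforated := forall (f g h : X -> nat) n,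
  bounded_lc f -> bounded_lc g -> bounded_lc h -> 0 < n ->
  fequidec alpha (fun x => n * g x) (fun x => h x + n * f x) ->
  exists2 d, bounded_lc d & fequidec alpha g (fun x => f x + d x).

Lemma T_cancellativeP : T_cancellative alpha <-> fcancellative.
Proof.
split=> H.
  move=> f g h bf bg bh e.
  rewrite -(height_undergraph bg) -(height_undergraph bh).
  apply: equidec_height; try exact: bclopen_undergraph.
  apply: (H (undergraph f)); try exact: bclopen_undergraph.
  apply/tsum_eq_height => [A|A|];
    try by rewrite !inE => /orP[] /eqP->; exact: bclopen_undergraph.
  under eq_fun do rewrite big_cons big_seq1 !height_undergraph //.
  by under [X in fequidec _ _ X]eq_fun do
    rewrite big_cons big_seq1 !height_undergraph //.
move=> A B C cA cB cC e; apply: height_equidec => //.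
apply: (H (height A)); try exact: bounded_lc_height.
move/tsum_eq_height : e.
under eq_fun do rewrite big_cons big_seq1.
under [X in fequidec _ _ X]eq_fun do rewrite big_cons big_seq1.
by apply=> D; rewrite !inE => /orP[] /eqP->.
Qed.

Lemma T_unperforatedP : T_unperforated alpha <-> funperforated.
Proof.
have snseq n (A : set (X * nat)) x :
    \sum_(B <- nseq n A) height B x = n * height A x.
  by rewrite big_nseq iter_addn_0 mulnC.
have mem_cn n (A B C : set (X * nat)) :
    bclopen A -> bclopen B -> C \in A :: nseq n B -> bclopen C.
  by move=> cA cB; rewrite inE mem_nseq => /orP[/eqP->|/andP[_ /eqP->]].
split=> H.
  move=> f g h n bf bg bh n0 e.
  have cf := bclopen_undergraph bf; have cg := bclopen_undergraph bg.
  have ch := bclopen_undergraph bh.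
  have [|D [cD hD]] := H (undergraph f) (undergraph g) cf cg n n0.
    exists (undergraph h); split=> //; apply/tsum_eq_height => [A|A|].
    - by rewrite mem_nseq => /andP[_ /eqP->].
    - exact: mem_cn.
    - under eq_fun do rewrite snseq height_undergraph //.
      by under [X in fequidec _ _ X]eq_fun do
        rewrite big_cons snseq !height_undergraph //.
  exists (height D); first exact: bounded_lc_height.
  move/tsum_eq_height : hD; under eq_fun do rewrite big_seq1 height_undergraph //.
  under [X in fequidec _ _ X]eq_fun do
    rewrite big_cons big_seq1 height_undergraph //.
  apply=> A; first by rewrite inE => /eqP->.
  by rewrite !inE => /orP[] /eqP->.
move=> A B cA cB n n0 [C [cC]] /tsum_eq_height e.
have {}e : fequidec alpha (fun x => n * height B x)
    (fun x => height C x + n * height A x).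
  under eq_fun do rewrite -snseq.
  under [X in fequidec _ _ X]eq_fun do rewrite -snseq -(big_cons _ _ _ _ xpredT (fun B => height B _)).
  apply: e => D; last exact: mem_cn.
  by rewrite mem_nseq => /andP[_ /eqP->].
have [d bd hd] := H _ _ _ _ (bounded_lc_height cA) (bounded_lc_height cB)
  (bounded_lc_height cC) n0 e.
have cd := bclopen_undergraph bd.
exists (undergraph d); split=> //; apply/tsum_eq_height => [D|D|].
- by rewrite inE => /eqP->.
- by rewrite !inE => /orP[] /eqP->.
- under eq_fun do rewrite big_seq1.
  by under [X in fequidec _ _ X]eq_fun do
    rewrite big_cons big_seq1 height_undergraph //.
Qed.

End TypeSemigroup.

(** * Averaging over finite subgroups *)

Section Generated.
Variable X : topologicalType.

Lemma gen_subgroup_sub (S K : set (X -> X)) :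
  is_subgroup K -> S `<=` K -> gen_subgroup S `<=` K.
Proof. by move=> gK SK f; apply. Qed.

Lemma sub_gen_subgroup (S : set (X -> X)) : S `<=` gen_subgroup S.
Proof. by move=> f Sf K _; apply. Qed.

Lemma cancel_inverse_uniq (f g h : X -> X) :
  cancel f g -> cancel g f -> cancel f h -> h = g.
Proof. by move=> fg gf fh; apply/funext => x; rewrite -{1}(gf x) fh. Qed.

(** The inverse of [f] is taken in [H]; by uniqueness of inverses it is also the one provided by
    every subgroup [K] containing [S]. *)
Lemma gen_subgroup_subgroup (S H : set (X -> X)) :
  is_subgroup H -> S `<=` H -> is_subgroup (gen_subgroup S).
Proof.
move=> gH SH; split.
- by apply: subset_trans (gen_subgroup_sub gH SH) _; case: gH.
- by move=> K [].
- by move=> f g gf gg K gK SK; case: (gK) => _ _ + _; apply; [exact: gf|exact: gg].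
- move=> f gf; have Hf := gen_subgroup_sub gH SH gf.
  have [_ _ _ /(_ _ Hf)[f' [_ fK f'K]]] := gH.
  exists f'; split=> // K gK SK.
  have [_ _ _ /(_ _ (gf K gK SK))[f'' [Kf'' fK' _]]] := gK.
  by rewrite -(cancel_inverse_uniq fK f'K fK').
Qed.

End Generated.

Section Average.
Variables (Gam : groupType) (X : topologicalType) (alpha : Gam -> X -> X).
Hypothesis actA : is_action alpha.

Section FiniteGroup.
Variable s : seq (X -> X).
Hypothesis s_uniq : uniq s.
Hypothesis s_group : is_subgroup [set` s].
Hypothesis s_full : [set` s] `<=` full_group alpha.

(** The sum over the finite group is not divided by the order of the group, so that values stay in
    [nat]. *)
Definition average (f : X -> nat) (x : X) := \sum_(k <- s) f (k x).

Lemma averageD f g x :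
  average (fun y => f y + g y) x = average f x + average g x.
Proof. exact: big_split. Qed.

Lemma averageM n f x : average (fun y => n * f y) x = n * average f x.
Proof. by rewrite /average big_distrr. Qed.

(** Left composition with [k'] permutes the elements of the group [s]. *)
Lemma average_invariant k k' f x :
  k \in s -> cancel k k' -> cancel k' k -> average (f \o k') x = average f x.
Proof.
move=> ks kK k'K; have [_ _ scomp /(_ k ks)[k'' [k''s kK'' _]]] := s_group.
have k's : k' \in s by rewrite -(cancel_inverse_uniq kK k'K kK'').
rewrite /average -[LHS](big_map (fun l => k' \o l) xpredT (fun l => f (l x))).
apply: perm_big; apply: uniq_perm => //.
  rewrite map_inj_uniq // => l m e; apply/funext => y.
  by apply: (can_inj k'K); exact: (congr1 (fun h => h y) e).
move=> l; apply/mapP/idP => [[m ms ->]|ls]; first exact: scomp.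
exists (k \o l); first exact: scomp.
by apply/funext => y /=; rewrite kK.
Qed.

Lemma average_ge f x : f x <= average f x.
Proof.
have [_ ids _ _] := s_group.
by rewrite /average (bigD1_seq (id : X -> X)) //= leq_addr.
Qed.

(** For each [k] in turn, the largest part of [f'] that [k] can carry into [g'], namely the minimum
    of [f'] and [g' \o k], is removed from [f'] and its image from [g']. Afterwards one of [f' x]
    and [g' (k x)] vanishes, and this persists since the remainders only decrease. *)
Lemma greedy_matching (t : seq (X -> X)) f g : {subset t <= s} ->
  bounded_lc f -> bounded_lc g ->
  exists f' g' m m' : X -> nat,
    [/\ bounded_lc f' /\ bounded_lc g',
        f = (fun x => f' x + m x) /\ g = (fun x => g' x + m' x),
        fequidec alpha m m',
        forall x, average m x = average m' x &
        forall k x, k \in t -> f' x = 0 \/ g' (k x) = 0].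
Proof.
move=> + bf bg; elim: t => [|k t ih] ts.
  exists f, g, (fun=> 0), (fun=> 0); split=> //.
  - by split; apply/funext => x; rewrite addn0.
  - exact/(fequidec_refl actA)/bounded_lc_cst.
have [|f' [g' [m [m' [[bf' bg'] [ef eg] em am zt]]]]] := ih.
  by move=> l lt; apply: ts; rewrite inE lt orbT.
have ks : k \in s by apply: ts; rewrite inE eqxx.
have [sh _ _ /(_ k ks)[k' [k's kK k'K]]] := s_group.
have ck : continuous k by have [] := sh _ ks.
have ck' : continuous k' by have [] := sh _ k's.
pose u x := minn (f' x) (g' (k x)); pose u' := u \o k'.
have bu : bounded_lc u.
  apply: (bounded_lc_le _ bf') => [|x]; last exact: geq_minl.
  apply: (locally_constant_comp2 minn bf'.1).
  exact: (locally_constant_precomp ck bg'.1).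
have bu' : bounded_lc u' by exact: bounded_lc_precomp.
have uf x : u x <= f' x by exact: geq_minl.
have ug x : u' x <= g' x by rewrite /u' /u /= k'K geq_minr.
exists (fun x => f' x - u x), (fun x => g' x - u' x).
exists (fun x => u x + m x), (fun x => u' x + m' x); split.
- split.
    apply: (bounded_lc_le _ bf') => [|x]; last exact: leq_subr.
    exact: (locally_constant_comp2 subn bf'.1 bu.1).
  apply: (bounded_lc_le _ bg') => [|x]; last exact: leq_subr.
  exact: (locally_constant_comp2 subn bg'.1 bu'.1).
- split; apply/funext => x.
    by rewrite ef addnA subnK.
  by rewrite eg addnA subnK.
- apply: fequidecD => //; apply: (fequidec_piecewise actA _ kK k'K bu).
  exact: s_full.
- by move=> x; rewrite !averageD am (average_invariant u x ks kK k'K).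
- move=> l x; rewrite inE => /orP[/eqP->|lt]; last first.
    by have [->|->] := zt l x lt; [left|right].
  rewrite /u' /= kK /u; case: (leqP (f' x) (g' (k x))) => h.
    by left; rewrite subnn.
  by right; rewrite subnn.
Qed.

Lemma average_le_fequidec f g : bounded_lc f -> bounded_lc g ->
  (forall x, average f x <= average g x) ->
  exists d, [/\ bounded_lc d, fequidec alpha g (fun x => f x + d x) &
    forall x, average g x = average f x + average d x].
Proof.
move=> bf bg fg.
have [f' [g' [m [m' [[bf' bg'] [ef eg] em am z]]]]] :=
  greedy_matching (fun k (ks : k \in s) => ks) bf bg.
(* If [f' x] were positive, [g'] would vanish on the whole orbit of [x]. Then
   [average g' x = 0 < average f' x], while the matched parts have equal averages, contradicting the
   hypothesis. *)
have f'0 x : f' x = 0.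
  apply/eqP; rewrite -leqn0 leqNgt; apply/negP => f'x.
  have g'0 : average g' x = 0.
    rewrite /average big_seq big1 // => k ks.
    by have [e|//] := z k x ks; rewrite e in f'x.
  have := fg x; rewrite ef eg !averageD am g'0.
  by have := average_ge f' x; lia.
have {}ef : f = m by rewrite ef; apply/funext => x; rewrite f'0.
exists g'; split=> //.
  rewrite eg ef [X in fequidec _ _ X](_ : _ = fun x => g' x + m x).
    apply: fequidecD; first exact: (fequidec_refl actA).
    exact: (fequidec_sym actA).
  by apply/funext => x; rewrite addnC.
by move=> x; rewrite eg ef averageD am addnC.
Qed.

(** The complement [d] given by the inequality has average zero, and [d] is dominated by its
    average. *)
Lemma average_eq_fequidec f g : bounded_lc f -> bounded_lc g ->
  (forall x, average f x = average g x) -> fequidec alpha f g.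
Proof.
move=> bf bg fg.
have [|d [_ gfd ad]] := average_le_fequidec bf bg; first by move=> x; rewrite fg.
apply: (fequidec_sym actA).
rewrite (_ : (fun x => _) = f) // in gfd; apply/funext => x.
by have := ad x; have := average_ge d x; rewrite fg; lia.
Qed.

End FiniteGroup.

(** * A dense locally finite subgroup forces cancellation and unperforation *)

Variable H : set (X -> X).
Hypothesis H_group : is_subgroup H.
Hypothesis H_full : H `<=` full_group alpha.
Hypothesis H_finite : locally_finite H.
Hypothesis H_dense : dense_in H (full_group alpha).

Lemma dense_image (c : Gam) (U : set X) : clopen U ->
  exists h, H h /\ h @` U = alpha c @` U.
Proof.
move=> cU; pose A (i : 'I_2) := if val i == 0 then U else ~` U.
have [|h [Hh hA]] := H_dense (full_group_act actA c) (A := A).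
  apply/clopen_partitionP/fin_partitionI => [i|x].
    by rewrite /A; case: ifP => // _; exact: clopenC.
  have [Ux|nU] := pselect (U x).
    exists ord0 => -[[|[|//]] ij]; rewrite /A /=; split=> //.
    by move=> _; exact: val_inj.
  exists ord_max => -[[|[|//]] ij]; rewrite /A /=; split=> //.
  by move=> _; exact: val_inj.
by exists h; split=> //; exact: (hA ord0).
Qed.

(** By density each translation of [U i] by [c i] is also effected by some [h i] in [H]. These
    finitely many [h i] generate a finite group, whose averages do not distinguish [U i] from its
    image. *)
Lemma fequidec_average f g : fequidec alpha f g ->
  exists s, [/\ uniq s, is_subgroup [set` s], [set` s] `<=` full_group alpha &
    forall x, average s f x = average s g x].
Proof.
move=> [I [U [c [cU fU gU]]]].
have /choice[h hP] i := dense_image (c i) (cU i).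
have HF : range h `<=` H by move=> _ [i _ <-]; exact: (hP i).1.
have Hfin : finite_set (gen_subgroup (range h)).
  by apply: H_finite.2 => //; apply: finite_image; exact: finite_finset.
have /finite_seqP[s0 es0] := Hfin.
pose s := undup s0.
have es : gen_subgroup (range h) = [set` s].
  by rewrite es0; apply/seteqP; split=> k /=; rewrite mem_undup.
have gs : is_subgroup [set` s].
  by rewrite -es; exact: gen_subgroup_subgroup H_group HF.
exists s; split=> //.
- exact: undup_uniq.
- rewrite -es; apply: subset_trans H_full; exact: gen_subgroup_sub H_group HF.
- move=> x.
  have sumE (V : I -> X -> nat) y : average s (fun z => \sum_i V i z) y =
      \sum_i average s (V i) y by rewrite /average exchange_big.
  rewrite (funext fU) (funext gU) !sumE; apply: eq_bigr => i _.
  have hs : h i \in s.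
    by have : gen_subgroup (range h) (h i); [apply: sub_gen_subgroup; exists i|rewrite es].
  have [_ _ _ /(_ _ hs)[h' [_ hK h'K]]] := gs.
  rewrite -(average_invariant (undup_uniq s0) gs (indicator (U i)) x hs hK h'K).
  congr (average s _ x); apply/funext => y /=; apply: eq_indicator.
  have /seteqP[h1 h2] := (hP i).2.
  split=> [Uy|Uy].
    have /h1[z Uz e] : [set h i x | x in U i] y by exists (h' y); rewrite ?h'K.
    by rewrite -e (actK actA).
  have /h2[z Uz e] : [set alpha (c i) x | x in U i] y.
    by exists (alpha (c i)^-1%g y) => //; rewrite (actVK actA).
  by rewrite -e hK.
Qed.

Lemma dense_locally_finite_cancellative : fcancellative alpha.
Proof.
move=> f g h bf bg bh /fequidec_average[s [us gs fs e]].
apply: (average_eq_fequidec us gs fs bg bh) => x.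
by have := e x; rewrite !averageD => /addnI.
Qed.

Lemma dense_locally_finite_unperforated : funperforated alpha.
Proof.
move=> f g h n bf bg bh n0 /fequidec_average[s [us gs fs e]].
have [x|d [bd gd _]] := average_le_fequidec us gs fs bf bg.
  by rewrite -(leq_pmul2l n0) -!averageM e averageD averageM leq_addl.
by exists d.
Qed.

End Average.

(** * Towers *)

Section Towers.
Variables (Gam : groupType) (X : topologicalType) (alpha : Gam -> X -> X).
Hypothesis actA : is_action alpha.

(* A finite partition of X into the clopen atoms [alpha c (base i)], where c
   runs over the levels of the i-th tower. *)
Record towers := Towers {
  index_of : finType;
  base : index_of -> set X;
  levels : index_of -> seq Gam;
  base_clopen : forall i, clopen (base i);
  towers_sum : forall x,
    \sum_i \sum_(c <- levels i) indicator (base i) (alpha c^-1%g x) = 1 }.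

Lemma big_levels (L : seq Gam) (F : Gam -> nat) :
  \sum_(c <- L) F c = \sum_(k < size L) F (nth 1%g L k).
Proof. by rewrite (big_nth 1%g) big_mkord. Qed.

Section Atoms.
Variable S : towers.

Definition atom_index := {i : index_of S & 'I_(size (levels i))}.

Definition atom_level (p : atom_index) : Gam :=
  nth 1%g (levels (tag p)) (tagged p).

Definition atom (p : atom_index) : set X :=
  [set x | base (tag p) (alpha (atom_level p)^-1%g x)].

Lemma mem_atom_level p : atom_level p \in levels (tag p).
Proof. exact/mem_nth/ltn_ord. Qed.

Lemma atom_levelP (i : index_of S) c : c \in levels i ->
  exists k : 'I_(size (levels i)), c = atom_level (Tagged _ k).
Proof.
move=> ci; have k : index c (levels i) < size (levels i) by rewrite index_mem.
by exists (Ordinal k); rewrite /atom_level /= nth_index.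
Qed.

Lemma atom_partition : fin_partition atom.
Proof.
split=> [p|x]; first exact/(clopen_act actA)/base_clopen.
rewrite -[RHS](towers_sum S x).
under [RHS]eq_bigr do rewrite big_levels.
by rewrite (sig_big_dep _ _ (fun i (k : 'I_(size (levels i))) =>
  indicator (base i) (alpha (nth 1%g (levels i) k)^-1%g x))).
Qed.

Lemma atom_act (i : index_of S) (k : 'I_(size (levels i))) u : base i u ->
  atom (Tagged _ k) (alpha (nth 1%g (levels i) k) u).
Proof. by move=> iu; rewrite /atom /= (actK actA). Qed.

Lemma level_inj (i : index_of S) c d u v : c \in levels i -> d \in levels i ->
  base i u -> base i v -> alpha c u = alpha d v -> c = d.
Proof.
move=> /atom_levelP[k ->] /atom_levelP[l ->] iu iv e.
have := atom_act k iu; have := atom_act l iv.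
rewrite -[alpha _ v]e => al ak.
by rewrite (fin_partition_uniq atom_partition ak al).
Qed.

(** On each tower [h] permutes the levels through the elements [d * c^-1]. The second clause is the
    first one for the inverse of [h], which makes the definition symmetric. *)
Definition tower_group : set (X -> X) :=
  [set h | homeo h /\ forall i : index_of S,
    (forall c, c \in levels i -> exists2 d, d \in levels i &
       forall u, base i u -> h (alpha c u) = alpha d u) /\
    (forall d, d \in levels i -> exists2 c, c \in levels i &
       forall u, base i u -> h (alpha c u) = alpha d u)].

(** Equivalently, [C] is a union of atoms. *)
Definition decides (C : set X) := forall (i : index_of S) c, c \in levels i ->
  (forall u, base i u -> C (alpha c u)) \/
  (forall u, base i u -> ~ C (alpha c u)).

Lemma tower_group_subgroup : is_subgroup tower_group.
Proof.
split.
- by move=> h [].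
- have cid : continuous (id : X -> X) by move=> x; exact: cvg_id.
  split=> [|i]; first by split=> //; exists id; split.
  by split=> c ci; exists c.
- move=> f g [[cf [f' [cf' fK f'K]]] hf] [[cg [g' [cg' gK g'K]]] hg]; split.
    split; first by move=> x; apply: continuous_comp; [exact: cg|exact: cf].
    exists (g' \o f'); split.
    + by move=> x; apply: continuous_comp; [exact: cf'|exact: cg'].
    + by move=> x /=; rewrite fK gK.
    + by move=> x /=; rewrite g'K f'K.
  move=> i; have [f1 f2] := hf i; have [g1 g2] := hg i; split=> [c ci|d di].
    have [d di gd] := g1 c ci; have [e ei fe] := f1 d di.
    by exists e => // u iu /=; rewrite gd // fe.
  have [e ei fe] := f2 d di; have [c ci gc] := g2 e ei.
  by exists c => // u iu /=; rewrite gc // fe.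
- move=> f [[cf [f' [cf' fK f'K]]] hf]; exists f'; split=> //; split.
    by split=> //; exists f.
  move=> i; have [f1 f2] := hf i; split=> [c ci|d di].
    by have [d di e] := f2 c ci; exists d => // u iu; rewrite -e // fK.
  by have [c ci e] := f1 d di; exists c => // u iu; rewrite -e // fK.
Qed.

Lemma tower_group_levels h : tower_group h ->
  exists d : atom_index -> Gam, forall p, d p \in levels (tag p) /\
    forall x, atom p x -> h x = alpha (d p * (atom_level p)^-1)%g x.
Proof.
move=> [_ hh].
suff /choice[d hd] : forall p : atom_index, exists d, d \in levels (tag p) /\
    forall x, atom p x -> h x = alpha (d * (atom_level p)^-1)%g x by exists d.
move=> p; have [/(_ _ (mem_atom_level p))[d dp hd] _] := hh (tag p).
by exists d; split=> // x px; rewrite (actM actA) -hd // (actVK actA).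
Qed.

Lemma tower_group_full h : tower_group h -> full_group alpha h.
Proof.
move=> gh; have [d hd] := tower_group_levels gh.
apply: (full_groupI gh.1 atom_partition
  (c := fun p => (d p * (atom_level p)^-1)%g)).
by move=> p x px; exact: (hd p).2.
Qed.

(** On an atom [h] acts by one group element. A fixed point forces the level to be sent to itself,
    by [level_inj], so the whole atom is fixed and the fixed set is a union of atoms. *)
Lemma tower_group_fixed h : tower_group h -> clopen [set x | h x = x].
Proof.
move=> gh; have [d hd] := tower_group_levels gh.
have [k [lk hk]] := fin_partition_index atom_partition.
have := clopen_preimage (fun p => d p = atom_level p) lk.
congr clopen; apply/seteqP; split=> x /= e.
  have /((hd _).2 _) -> : atom (k x) x by apply/hk.
  by rewrite e mulgV (act1 actA).
have ax : atom (k x) x by apply/hk.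
apply: (level_inj (hd _).1 (mem_atom_level _) ax ax).
by rewrite -(actM actA) -(hd _).2 // e (actVK actA).
Qed.

(** An element is determined by the map it induces on the finite set of atoms. *)
Lemma tower_group_finite : finite_set tower_group.
Proof.
have [k [_ hk]] := fin_partition_index atom_partition.
pose F (phi : {ffun atom_index -> atom_index}) x :=
  alpha (atom_level (phi (k x)) * (atom_level (k x))^-1)%g x.
apply: (@sub_finite_set _ _ (range F)); last first.
  by apply: finite_image; exact: finite_finset.
move=> h /tower_group_levels[d hd].
have /choice[phi hphi] p : exists q, d p = atom_level q.
  by have [k' ->] := atom_levelP (hd p).1; eexists.
exists (finfun phi) => //.
apply/funext => x; rewrite /F ffunE -hphi; apply/esym/(hd _).2.
exact/hk.
Qed.

(** Each piece is a union of atoms, so every atom is moved as a whole by a single [g k]. *)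
Lemma tower_group_glue (K : finType) (A : K -> set X) (g : K -> X -> X) h :
  homeo h -> fin_partition A -> (forall k, decides (A k)) ->
  (forall k, tower_group (g k)) -> (forall k x, A k x -> h x = g k x) ->
  tower_group h.
Proof.
move=> hh pA dA gg hA; split=> // i.
have [[u0 iu0]|ni] := pselect (exists u, base i u); last first.
  by split=> c ci; exists c => // u iu; exfalso; apply: ni; exists u.
have [ch [h' [ch' hK h'K]]] := hh.
have in_piece c k : c \in levels i -> A k (alpha c u0) ->
    forall u, base i u -> A k (alpha c u).
  by move=> ci Ak; case: (dA k i c ci) => // /(_ u0 iu0).
split=> [c ci|d di].
  have [k /(_ k)[_ /(_ erefl) Ak]] := fin_partition_ex (alpha c u0) pA.
  have [/(_ _ ci)[d di gd] _] := (gg k).2 i.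
  by exists d => // u iu; rewrite (hA k) ?gd //; exact: in_piece Ak _ iu.
(* The level sent to [d] is located through the preimage of one point of the atom of [d]. *)
pose y := h' (alpha d u0).
have [k /(_ k)[_ /(_ erefl) Ak]] := fin_partition_ex y pA.
have [_ /(_ _ di)[c ci gc]] := (gg k).2 i.
have [_ [g' [_ gK _]]] := (gg k).1.
have ey : alpha c u0 = y.
  by apply: (can_inj gK); rewrite gc // -(hA k) // h'K.
by exists c => // u iu; rewrite (hA k) ?gc //; apply: in_piece iu; rewrite ?ey.
Qed.

End Atoms.

(** * Refinement of towers and level counts *)

(** Each tower of [S'] is made of complete translates, by elements [b], of towers of [S] over
    smaller bases. Completeness, the last clause, is what lets permutations of the levels of [S] act
    on those of [S']. *)
Definition refines (S' S : towers) := forall (i' : index_of S') c',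
  c' \in levels i' -> exists (i : index_of S) c b,
    [/\ c \in levels i, c' = (c * b)%g,
        forall u, base i' u -> base i (alpha b u) &
        forall d, d \in levels i -> (d * b)%g \in levels i'].

Lemma refines_refl S : refines S S.
Proof.
move=> i c ci; exists i, c, 1%g; split=> //; first by rewrite mulg1.
  by move=> u; rewrite (act1 actA).
by move=> d; rewrite mulg1.
Qed.

Lemma refines_trans S3 S2 S1 : refines S3 S2 -> refines S2 S1 -> refines S3 S1.
Proof.
move=> r32 r21 i3 c3 /r32[i2 [c2 [b2 [/r21[i1 [c1 [b1 [c1i -> h1 l1]]]] -> h2 l2]]]].
exists i1, c1, (b1 * b2)%g; split=> //; first by rewrite mulgA.
  by move=> u /h2/h1; rewrite (actM actA).
by move=> d /l1/l2; rewrite mulgA.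
Qed.

Lemma refines_tower_group S' S : refines S' S -> tower_group S `<=` tower_group S'.
Proof.
move=> r h [hh gh]; split=> // i'; split=> [c' /r|c' /r];
  move=> [i [c [b [ci -> bi bl]]]]; have [h1 h2] := gh i.
  have [d di hd] := h1 c ci; exists (d * b)%g; first exact: bl.
  by move=> u iu; rewrite !(actM actA) hd //; exact: bi.
have [d di hd] := h2 c ci; exists (d * b)%g; first exact: bl.
by move=> u iu; rewrite !(actM actA) hd //; exact: bi.
Qed.

Lemma refines_decides S' S C : refines S' S -> decides S C -> decides S' C.
Proof.
move=> r dC i' c' /r[i [c [b [ci -> bi _]]]].
by case: (dC i c ci) => h; [left|right] => u /bi/h; rewrite (actM actA).
Qed.

Lemma trivial_towers_sum x :
  \sum_(i : unit) \sum_(c <- [:: 1%g : Gam])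
    indicator (setT : set X) (alpha c^-1%g x) = 1.
Proof. by rewrite big_const card_unit /= big_seq1 indicatorT. Qed.

Definition trivial_towers :=
  Towers (fun=> clopenT) trivial_towers_sum.

(** Each base is split according to the pattern of levels at which the point lands in [C]. The
    maximal height [M] lets the patterns of all towers live in one finite type. *)
Lemma refine_decides S C : clopen C ->
  exists2 S', refines S' S & decides S' C.
Proof.
move=> cC; pose M := \max_(i : index_of S) size (levels i).
pose pat i u := [ffun k : 'I_M => `[< C (alpha (nth 1%g (@levels S i) k) u) >]].
pose I' := (index_of S * {ffun 'I_M -> bool})%type.
pose B (q : I') := [set u | base q.1 u /\ pat q.1 u = q.2].
have cB q : clopen (B q).
  apply: clopenI; first exact: base_clopen.
  apply: (@clopen_preimage _ _ (pat q.1) (fun v => v = q.2)).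
  apply: locally_constant_ffun => k; apply: clopen_locally_constant.
  exact: (clopen_act actA).
have sB x : \sum_q \sum_(c <- levels q.1) indicator (B q) (alpha c^-1%g x) = 1.
  rewrite -[RHS](towers_sum S x) -(pair_big xpredT xpredT (fun i v =>
    \sum_(c <- levels i) indicator (B (i, v)) (alpha c^-1%g x))) /=.
  apply: eq_bigr => i _; rewrite exchange_big; apply: eq_bigr => c _.
  apply/esym/indicator_sumI => [|v w [_ /= <-] [_ /= <-] //].
  by split=> [iu|[v []]//]; exists (pat i (alpha c^-1%g x)).
exists (Towers cB sB).
  move=> [i v] c /= ci; exists i, c, 1%g; split=> //; first by rewrite mulg1.
    by move=> u []; rewrite (act1 actA).
  by move=> d; rewrite mulg1.
move=> [i v] c /= ci.
have kM : index c (levels i) < M.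
  by apply: leq_trans (leq_bigmax i); rewrite index_mem.
have vE u : B (i, v) u -> v (Ordinal kM) = `[< C (alpha c u) >].
  by move=> [_ /= <-]; rewrite ffunE /= nth_index.
case e : (v (Ordinal kM)); [left|right] => u /vE; rewrite e => /esym.
  by move/asboolP.
by move=> /asboolP.
Qed.

(** Over an empty [U] every level is counted, for any [C]; hence a tower with empty base has
    imbalance zero. *)
Definition level_count (U : set X) (C : set X) (L : seq Gam) :=
  count (fun c => `[< forall u, U u -> C (alpha c u) >]) L.

Lemma level_count_empty U C L : (forall u, ~ U u) -> level_count U C L = size L.
Proof.
move=> nU; apply/eqP; rewrite -all_count; apply/allP => c _.
by apply/asboolP => u /nU.
Qed.

Lemma decides_level S C i c u : decides S C -> c \in @levels S i -> base i u ->
  C (alpha c u) <-> forall v, base i v -> C (alpha c v).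
Proof.
move=> dC ci iu; split; last by apply.
by case: (dC i c ci) => // /(_ u iu).
Qed.

Lemma level_count_shift S C i (b : Gam) (U : set X) u : decides S C ->
  U u -> (forall v, U v -> base i (alpha b v)) ->
  level_count U C [seq (c * b)%g | c <- @levels S i] =
  level_count (base i) C (levels i).
Proof.
move=> dC Uu Ub; rewrite /level_count count_map; apply: eq_in_count => c ci /=.
apply/asboolP/asboolP => h v iv.
  by apply: (iffLR (decides_level dC ci (Ub _ Uu))) iv; rewrite -(actM actA); exact: h.
by rewrite (actM actA); apply: h; exact: Ub.
Qed.

(** Every atom contained in [C] is moved down to the base of its tower. *)
Lemma fequidec_level_count S C : clopen C -> decides S C ->
  fequidec alpha (indicator C)
    (fun x => \sum_(i : index_of S)
       level_count (base i) C (levels i) * indicator (base i) x).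
Proof.
move=> cC dC.
pose P i c := `[< forall u, @base S i u -> C (alpha c u) >].
have eC : indicator C = fun x => \sum_(i : index_of S) \sum_(c <- levels i)
    (P i c * indicator (base i) (alpha c^-1%g x)).
  apply/funext => x; rewrite -[LHS]muln1 -(towers_sum S x) big_distrr /=.
  apply: eq_bigr => i _; rewrite big_distrr /= !big_seq; apply: eq_bigr => c ci.
  have [iu|ni] := pselect (base i (alpha c^-1%g x)); last first.
    by rewrite (indicatorF ni) !muln0.
  rewrite (indicatorT iu) !muln1 /indicator; congr nat_of_bool.
  apply: asbool_equiv_eq; rewrite -(decides_level dC ci iu).
  by rewrite (actVK actA).
rewrite eC; apply: (fequidec_sym actA).
rewrite (_ : (fun x => \sum_i _ * _) = fun x => \sum_(i : index_of S)
    \sum_(c <- levels i) (P i c * indicator (base i) x)).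
  apply: (fequidec_sum actA) => i; apply: (fequidec_sum actA) => c.
  apply: (fequidec_act actA c (f := fun x => P i c * indicator (base i) x)).
  exact/bounded_lcM/bounded_lc_indicator/base_clopen.
apply/funext => x; apply: eq_bigr => i _.
by rewrite -big_distrl /level_count -sum1_count big_mkcond.
Qed.

(* Subtraction is truncated, so this is the absolute value of e - f. *)
Definition imbalance S (C D : set X) (i : index_of S) :=
  let e := level_count (base i) C (levels i) in
  let f := level_count (base i) D (levels i) in (e - f) + (f - e).

Lemma imbalanceC S C D i : @imbalance S C D i = imbalance D C i.
Proof. by rewrite /imbalance addnC. Qed.

(** List the levels of each tower with those inside [C] first, and likewise for [D]. As the counts
    agree, sending the [k]-th level of the first list to the [k]-th of the second carries [C] onto
    [D]. *)
Lemma balanced_tower_group S C D : decides S C -> decides S D ->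
  (forall i, @imbalance S C D i = 0) ->
  exists2 h, tower_group S h & forall x, C x <-> D (h x).
Proof.
move=> dC dD bal.
pose P E i c := `[< forall u, @base S i u -> E (alpha c u) >].
pose L E i := seq.filter (P E i) (levels i) ++ seq.filter (predC (P E i)) (levels i).
have pL E i : perm_eq (L E i) (levels i) by rewrite /L perm_filterC.
have sL E i : size (L E i) = size (levels i) by exact: perm_size.
have nthL E i k : k < size (levels i) -> nth 1%g (L E i) k \in levels i.
  by move=> ki; rewrite -(perm_mem (pL E i)) mem_nth // sL.
have PL E i k : k < size (levels i) ->
    P E i (nth 1%g (L E i) k) = (k < count (P E i) (levels i)).
  move=> ki; rewrite /L nth_cat size_filter; case: ifP => kE.
    have := @mem_nth _ 1%g (seq.filter (P E i) (levels i)) k.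
    by rewrite size_filter mem_filter => /(_ kE)/andP[].
  have k2 : k - count (P E i) (levels i) < count (predC (P E i)) (levels i).
    by rewrite ltn_subLR ?count_predC // leqNgt kE.
  have := @mem_nth _ 1%g (seq.filter (predC (P E i)) (levels i)) _.
  by rewrite size_filter => /(_ _ k2); rewrite mem_filter => /andP[/negbTE].
have sumL E x : \sum_i \sum_(k < size (@levels S i))
    indicator (base i) (alpha (nth 1%g (L E i) k)^-1%g x) = 1.
  rewrite -[RHS](towers_sum S x); apply: eq_bigr => i _.
  by rewrite -(perm_big _ (pL E i)) big_levels sL.
pose a E (p : atom_index S) := nth 1%g (L E (tag p)) (tagged p).
have sumA E x : \sum_p indicator (base (tag p)) (alpha (a E p)^-1%g x) = 1.
  rewrite -[RHS](sumL E x) (sig_big_dep _ _ (fun i (k : 'I_(size (@levels S i))) =>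
    indicator (base i) (alpha (nth 1%g (L E i) k)^-1%g x))) //.
pose A (p : atom_index S) := [set x | base (tag p) (alpha (a C p)^-1%g x)].
have pA : fin_partition A.
  by split=> [p|x]; [exact/(clopen_act actA)/base_clopen|exact: sumA].
have [|||||h [hh hA]] := @homeo_glue _ _ A
    (fun p => alpha (a D p * (a C p)^-1)%g)
    (fun p => alpha (a C p * (a D p)^-1)%g) pA.
- by move=> p; exact: act_continuous.
- by move=> p; exact: act_continuous.
- by move=> p x; rewrite -(actM actA) mulgA mulgVK mulgV (act1 actA).
- by move=> p x; rewrite -(actM actA) mulgA mulgVK mulgV (act1 actA).
- move=> x; rewrite -[RHS](sumA D x); apply: eq_bigr => p _.
  by apply: eq_indicator; rewrite /A /= -(actM actA) mulKg.
have hap p u : base (tag p) u -> h (alpha (a C p) u) = alpha (a D p) u.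
  move=> pu; rewrite (hA p) ?(actM actA) ?(actK actA) //.
  by rewrite /A /= (actK actA).
have aP E i c : c \in @levels S i -> exists k : 'I_(size (levels i)),
    a E (Tagged (fun i => 'I_(size (levels i))) k) = c.
  rewrite -(perm_mem (pL E i)) => ci.
  have k : index c (L E i) < size (levels i) by rewrite -(sL E) index_mem.
  by exists (Ordinal k); rewrite /a /= nth_index.
exists h.
  split=> // i; split=> [c /(aP C)[k <-]|d /(aP D)[k <-]].
    exists (a D (Tagged _ k)); first exact: nthL (ltn_ord k).
    by move=> u iu; exact: (hap (Tagged _ k)).
  exists (a C (Tagged _ k)); first exact: nthL (ltn_ord k).
  by move=> u iu; exact: (hap (Tagged _ k)).
move=> x; have [p /(_ p)[_ /(_ erefl) px]] := fin_partition_ex x pA.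
pose u := alpha (a C p)^-1%g x.
have -> : x = alpha (a C p) u by rewrite /u (actVK actA).
have kp := ltn_ord (tagged p).
rewrite hap // (decides_level dC (nthL _ _ _ kp) px).
rewrite (decides_level dD (nthL _ _ _ kp) px).
suff : P C (tag p) (a C p) = P D (tag p) (a D p).
  by move=> e; split=> [/asboolP|/asboolP]; rewrite -/(P _ _ _);
    [rewrite e|rewrite -e] => /asboolP.
rewrite /a !PL //; congr (_ < _).
by have := bal (tag p); rewrite /imbalance /level_count -!/(P _ _); lia.
Qed.

End Towers.

(** * Balancing towers *)

Section Absorption.
Variables (Gam : groupType) (X : topologicalType) (alpha : Gam -> X -> X).
Hypothesis actA : is_action alpha.

(** An inequality in the semigroup becomes an actual embedding: [A] is first distributed among the
    translates [V' j], then the pieces, moved back by [c j], are distributed among the [Q t]. *)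
Lemma fequidec_embed (T : finType) (Q : T -> set X) (A : set X) d :
  clopen A -> (forall t, clopen (Q t)) ->
  fequidec alpha (fun x => \sum_t indicator (Q t) x)
                 (fun x => indicator A x + d x) ->
  exists (J : finType) (B : J -> T -> set X) (c : J -> Gam),
    [/\ forall j t, clopen (B j t),
        forall t x, \sum_j indicator (B j t) x <= indicator (Q t) x &
        forall x, indicator A x =
          \sum_j \sum_t indicator (B j t) (alpha (c j)^-1%g x)].
Proof.
move=> cA cQ [J [V [c [cV gV hV]]]].
pose V' j := [set x | V j (alpha (c j)^-1%g x)].
have cV' j : clopen (V' j) by exact: (clopen_act actA).
have [x|D [cD AD DV _]] := Riesz_refinement (fun _ : unit => cA) cV'.
  rewrite big_const card_unit /= addn0.
  by apply: leq_trans (leq_addr (d x) _) _; rewrite hV.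
pose P j := [set x | D tt j (alpha (c j) x)].
have cP j : clopen (P j) by exact: (clopen_act actA).
have [x|B [cB PB BQ _]] := Riesz_refinement cP cQ.
  rewrite gV; apply: leq_sum => j _; apply: leq_trans (_ : _ <= indicator (V' j) (alpha (c j) x)) _.
    by apply: leq_trans (DV j (alpha (c j) x)); rewrite (bigD1 tt) //= leq_addr.
  by rewrite (eq_indicator (B := V j) (y := x)) // /V' /= (actK actA).
exists J, B, c; split=> // x.
rewrite (AD tt); apply: eq_bigr => j _; rewrite -PB.
by apply: eq_indicator; rewrite /P /= (actVK actA).
Qed.

End Absorption.

Section Balancing.
Variables (Gam : groupType) (X : topologicalType) (alpha : Gam -> X -> X).
Hypothesis actA : is_action alpha.
Hypothesis fcanc : fcancellative alpha.
Hypothesis funpf : funperforated alpha.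

Local Notation towers := (towers alpha).

Definition deficit_base (S : towers) (C D : set X) (i : index_of S) : set X :=
  if level_count alpha (base i) C (levels i) <
     level_count alpha (base i) D (levels i) then base i else set0.

(* If every imbalance is at most K and tower i0 has excess K of C-levels, then
   [K * base i0 <= K * (sum of the bases with a deficit)] in the type semigroup,
   so that unperforation embeds base i0 in the union of these bases. *)
Lemma excess_absorbed (S : towers) C D K (i0 : index_of S) :
  clopen C -> clopen D -> decides S C -> decides S D ->
  fequidec alpha (indicator C) (indicator D) ->
  (forall i : index_of S, imbalance C D i <= K) -> 0 < K ->
  level_count alpha (base i0) C (levels i0) =
    level_count alpha (base i0) D (levels i0) + K ->
  exists2 d, bounded_lc d & fequidec alpha
    (fun x => \sum_(i : index_of S) indicator (deficit_base C D i) x)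
    (fun x => indicator (base i0) x + d x).
Proof.
move=> cC cD dC dD CD leK K0.
set e := fun i : index_of S => level_count alpha (base i) C (levels i).
set f := fun i : index_of S => level_count alpha (base i) D (levels i).
move=> ei0; set Q := @deficit_base S C D.
have bU (k : index_of S -> nat) (P : pred (index_of S)) :
    bounded_lc (fun x => \sum_(i | P i) k i * indicator (base i) x).
  apply: bounded_lc_sum => i; apply/bounded_lcM/bounded_lc_indicator.
  exact: base_clopen.
have ef : fequidec alpha (fun x => \sum_i e i * indicator (base i) x)
    (fun x => \sum_i f i * indicator (base i) x).
  have hC := fequidec_level_count actA cC dC.
  have hD := fequidec_level_count actA cD dD.
  apply: (fequidec_trans actA (fequidec_sym actA hC)).
  exact: (fequidec_trans actA CD hD).
(* Cancelling the common part [minn (e i) (f i)] leaves the excesses against the deficits. *)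
have {}ef : fequidec alpha (fun x => \sum_i (e i - f i) * indicator (base i) x)
    (fun x => \sum_i (f i - e i) * indicator (base i) x).
  apply: (fcanc (f := fun x => \sum_i minn (e i) (f i) * indicator (base i) x)) => //.
  rewrite [X in fequidec _ X _](_ : _ = fun x => \sum_i e i * indicator (base i) x).
    rewrite [X in fequidec _ _ X](_ : _ = fun x => \sum_i f i * indicator (base i) x) //.
    apply/funext => x; rewrite -big_split; apply: eq_bigr => i _ /=.
    by rewrite -mulnDl; congr (_ * _); lia.
  apply/funext => x; rewrite -big_split; apply: eq_bigr => i _ /=.
  by rewrite -mulnDl; congr (_ * _); lia.
have indQ i x : indicator (Q i) x = (e i < f i) * indicator (base i) x.
  rewrite /Q /deficit_base -/(e i) -/(f i); case: ifP => _; first by rewrite mul1n.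
  by rewrite indicatorF.
(* [r i] tops the deficit of tower [i] up to exactly [K], so that deficits plus [r] give [K] times
   the sum of the deficit bases. *)
pose r i := (e i < f i) * (K - (f i - e i)).
have bQ : bounded_lc (fun x => \sum_i indicator (Q i) x).
  by under eq_fun do under eq_bigr do rewrite indQ.
(* The excess of tower [i0] supplies [K * base i0]; the excesses of the other towers and the added
   [r] form the complement. *)
apply: (@funpf (indicator (base i0)) _ (fun x =>
  \sum_(i | i != i0) (e i - f i) * indicator (base i) x +
  \sum_i r i * indicator (base i) x) K) => //.
- exact/bounded_lc_indicator/base_clopen.
- exact: bounded_lcD.
- have := fequidecD (fequidec_sym actA ef) (fequidec_refl actA (bU r xpredT)).
  congr fequidec; apply/funext => x.
    rewrite -big_split big_distrr /=; apply: eq_bigr => i _.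
    rewrite indQ -mulnDl mulnA; congr (_ * _); rewrite /r.
    have := leK i; rewrite /imbalance -/(e i) -/(f i); case: ltnP; lia.
  rewrite [in LHS](bigD1 i0) //=.
  by rewrite (_ : e i0 - f i0 = K); [lia|rewrite /e ei0 /f; lia].
Qed.

(** * Gluing one tower on top of others *)

Section Merge.
Variables (S : towers) (i0 : index_of S) (J : finType).
Variables (B : J -> index_of S -> set X) (c : J -> Gam).
Hypothesis cB : forall j t, clopen (B j t).
Hypothesis B_base : forall t x, \sum_j indicator (B j t) x <=
  (t != i0) * indicator (base t) x.
Hypothesis B_sum : forall x, indicator (base i0) x =
  \sum_j \sum_t indicator (B j t) (alpha (c j)^-1%g x).

(* [inl t] is what remains of tower t, and [inr (j, t)] is the piece of tower t
   over B j t, to which the piece of tower i0 over c j (B j t) is added. *)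
Definition merged_index : finType := (index_of S + J * index_of S)%type.

(** For [t != i0] the strict inequality selects the points of [base t] lying in no [B j t]; for
    [t = i0] it leaves nothing. *)
Definition merged_base (k : merged_index) : set X :=
  match k with
  | inl t => [set x | \sum_j indicator (B j t) x < (t != i0) * indicator (base t) x]
  | inr p => B p.1 p.2
  end.

Definition merged_levels (k : merged_index) : seq Gam :=
  match k with
  | inl t => levels t
  | inr p => levels p.2 ++ [seq (a * c p.1)%g | a <- levels i0]
  end.

Lemma merged_clopen k : clopen (merged_base k).
Proof.
case: k => [t|p]; last exact: cB.
apply: (@clopen_preimage _ _ (fun x =>
  (\sum_j indicator (B j t) x, (t != i0) * indicator (base t) x))
  (fun p => p.1 < p.2)).
apply: (locally_constant_comp2 pair).
  by apply: locally_constant_sum => j; exact: indicator_locally_constant.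
apply: (locally_constant_comp (muln (t != i0))).
exact/indicator_locally_constant/base_clopen.
Qed.

Lemma merged_base_inl t x : indicator (merged_base (inl t)) x +
  \sum_j indicator (B j t) x = (t != i0) * indicator (base t) x.
Proof.
have le := B_base t x.
have le1 : (t != i0) * indicator (base t) x <= 1.
  by case: (t != i0); rewrite // mul1n indicator_le1.
have -> : indicator (merged_base (inl t)) x =
    (\sum_j indicator (B j t) x < (t != i0) * indicator (base t) x).
  by rewrite {1}/indicator /merged_base /= asboolb.
move: le le1; set a := \sum_j _; set b := _ * _ => ab b1.
by case: ltnP => /=; lia.
Qed.

(** The remainders and the first halves of the glued towers add up to the towers [t != i0], by
    [merged_base_inl]; the second halves add up to tower [i0], by [B_sum]. *)
Lemma merged_sum x : \sum_k \sum_(a <- merged_levels k)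
  indicator (merged_base k) (alpha a^-1%g x) = 1.
Proof.
rewrite big_sumType /= -[RHS](towers_sum S x).
rewrite -(pair_big xpredT xpredT (fun j t =>
  \sum_(a <- levels t ++ [seq (a * c j)%g | a <- levels i0])
    indicator (B j t) (alpha a^-1%g x))) /=.
under [X in _ + X]eq_bigr do under eq_bigr do rewrite big_cat big_map /=.
under [X in _ + X]eq_bigr do rewrite big_split /=.
rewrite big_split /= [X in _ + (X + _)]exchange_big addnA -big_split /=.
rewrite [RHS](bigD1 i0) //= addnC; congr (_ + _).
  under eq_bigr do rewrite exchange_big.
  rewrite exchange_big; apply: eq_bigr => a _; rewrite B_sum.
  by do 2 apply: eq_bigr => ? _; rewrite invgM (actM actA).
rewrite [RHS]big_mkcond; apply: eq_bigr => t _.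
rewrite [X in _ + X]exchange_big -big_split /=.
under eq_bigr do rewrite merged_base_inl.
by rewrite -big_distrr /=; case: (t != i0); rewrite ?mul1n ?mul0n.
Qed.

Definition merged : towers := Towers merged_clopen merged_sum.

Lemma B_sub j t x : B j t x -> t != i0 /\ base t x.
Proof.
move=> Bx; have := B_base t x; rewrite (bigD1 j) //= indicatorT //.
case: (t != i0) => //; rewrite mul1n => h; split=> //.
by apply: indicator_gt0; lia.
Qed.

Lemma B_act j t x : B j t x -> base i0 (alpha (c j) x).
Proof.
move=> Bx; apply: indicator_gt0; rewrite B_sum (bigD1 j) //= (bigD1 t) //=.
by rewrite indicatorT // (actK actA).
Qed.

Lemma merged_refines : refines merged S.
Proof.
move=> [t|[j t]] a /=.
  move=> ai; exists t, a, 1%g; split=> //; first by rewrite mulg1.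
    move=> u /= h; rewrite (act1 actA); apply: indicator_gt0.
    by move: h; case: (t != i0); rewrite ?mul1n //; lia.
  by move=> d; rewrite mulg1.
rewrite mem_cat => /orP[ai|/mapP[b bi ->]].
  exists t, a, 1%g; split=> //; first by rewrite mulg1.
    by move=> u /B_sub[_]; rewrite (act1 actA).
  by move=> d di; rewrite mulg1 mem_cat di.
exists i0, b, (c j); split=> //; first by move=> u /B_act.
by move=> d di; rewrite mem_cat (map_f (fun a => (a * c j)%g)) ?orbT.
Qed.

Lemma level_count_sub E (t : index_of S) (U : set X) u : decides S E -> U u ->
  U `<=` base t -> level_count alpha U E (levels t) =
    level_count alpha (base t) E (levels t).
Proof.
move=> dE Uu Ut; rewrite -(level_count_shift actA dE (b := 1%g) Uu).
  by rewrite (eq_map (mulg1 (s := Gam))) map_id.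
by move=> v /Ut; rewrite (act1 actA).
Qed.

Variables C D : set X.
Hypothesis dC : decides S C.
Hypothesis dD : decides S D.

Lemma imbalance_empty (S' : towers) (i : index_of S') :
  (forall u, ~ base i u) -> imbalance C D i = 0.
Proof. by move=> n; rewrite /imbalance !level_count_empty // subnn. Qed.

Lemma imbalance_inl t :
  @imbalance _ _ alpha merged C D (inl t) = 0 \/
  t != i0 /\ @imbalance _ _ alpha merged C D (inl t) = imbalance C D t.
Proof.
have [[u ut]|nu] := pselect (exists u, merged_base (inl t) u); last first.
  by left; apply: imbalance_empty => u ut; apply: nu; exists u.
have sub v : merged_base (inl t) v -> t != i0 /\ base t v.
  rewrite /merged_base /=; case: (t != i0); rewrite ?mul1n //= => h.
  by split=> //; apply: indicator_gt0; lia.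
right; split; first by have [] := sub u ut.
rewrite /imbalance /= !(level_count_sub (U := merged_base (inl t)) _ ut) //.
- by move=> v /sub[].
- by move=> v /sub[].
Qed.

(** Signed imbalances add under gluing: [K] from tower [i0] and a value between [-K] and [-1] from
    tower [t] give a total between 0 and [K - 1]. *)
Lemma imbalance_inr K j t : 0 < K ->
  level_count alpha (base i0) C (levels i0) =
    level_count alpha (base i0) D (levels i0) + K ->
  imbalance C D t <= K ->
  (forall u, B j t u -> level_count alpha (base t) C (levels t) <
    level_count alpha (base t) D (levels t)) ->
  @imbalance _ _ alpha merged C D (inr (j, t)) < K.
Proof.
move=> K0 e0 tK lt.
have [[u ut]|nu] := pselect (exists u, B j t u); last first.
  by rewrite imbalance_empty // => u ut; apply: nu; exists u.
have tb : B j t `<=` base t by move=> v /B_sub[].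
rewrite /imbalance /= /level_count !count_cat -!/(level_count _ _ _ _).
rewrite !(level_count_sub _ ut tb) //.
rewrite !(level_count_shift actA _ ut (@B_act j t)) //.
have := lt u ut; move: tK e0; rewrite /imbalance; lia.
Qed.

End Merge.

(** After gluing [i0] onto the deficit towers, imbalance [K] can only occur on remainders of towers
    that had it already, and [i0] is no longer among them. *)
Lemma balance_step (S : towers) C D K (i0 : index_of S) :
  clopen C -> clopen D -> decides S C -> decides S D ->
  fequidec alpha (indicator C) (indicator D) ->
  (forall i : index_of S, imbalance C D i <= K) -> 0 < K ->
  level_count alpha (base i0) C (levels i0) =
    level_count alpha (base i0) D (levels i0) + K ->
  exists S' : towers, [/\ refines S' S,
    forall i : index_of S', imbalance C D i <= K &
    #|[set i : index_of S' | imbalance C D i == K]%SET| <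
    #|[set i : index_of S | imbalance C D i == K]%SET|].
Proof.
move=> cC cD dC dD CD leK K0 e0.
have [d bd hQ] := excess_absorbed cC cD dC dD CD leK K0 e0.
have cQ (i : index_of S) : clopen (deficit_base C D i).
  by rewrite /deficit_base; case: ifP => _; [exact: base_clopen|exact: clopen0].
have [J [B [c [cB BQ sB]]]] := fequidec_embed actA (base_clopen i0) cQ hQ.
have Bb t x : \sum_j indicator (B j t) x <= (t != i0) * indicator (base t) x.
  apply: leq_trans (BQ t x) _; rewrite /deficit_base; case: ifP => h; last by rewrite indicatorF.
  have -> : t != i0 by apply: contraTneq h => ->; rewrite e0; lia.
  by rewrite mul1n.
have Blt j t u : B j t u -> level_count alpha (base t) C (levels t) <
    level_count alpha (base t) D (levels t).
  move=> Bu; have := BQ t u; rewrite (bigD1 j) //= indicatorT // /deficit_base.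
  by case: ifP => // _; rewrite indicatorF.
have inrK j t : @imbalance _ _ alpha (merged cB Bb sB) C D (inr (j, t)) < K.
  by apply: imbalance_inr => //; exact: Blt.
exists (merged cB Bb sB); split; first exact: merged_refines.
  move=> [t|[j t]]; last exact/ltnW/inrK.
  by have [->|[_ ->]] := imbalance_inl cB Bb sB dC dD t.
rewrite [X in _ < X](cardsD1 i0) inE.
have -> : imbalance C D i0 == K by apply/eqP; rewrite /imbalance e0; lia.
rewrite add1n ltnS; set A := (X in _ <= #|pred_of_set X|).
pose inM (t : index_of S) : index_of (merged cB Bb sB) := inl t.
apply: leq_trans _ (leq_imset_card inM A).
apply/subset_leq_card/fintype.subsetP => -[t|[j t]]; rewrite inE => /eqP e; last first.
  by have := inrK j t; rewrite e ltnn.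
apply: (imset_f inM).
have [e'|[ti0 e']] := imbalance_inl cB Bb sB dC dD t.
  by rewrite e' in e; rewrite -e in K0.
by rewrite !inE ti0 -e' e eqxx.
Qed.

(** Lexicographic induction on a bound [K] for the imbalances and on the number of towers attaining
    it. *)
Lemma balance (S : towers) C D :
  clopen C -> clopen D -> decides S C -> decides S D ->
  fequidec alpha (indicator C) (indicator D) ->
  exists2 S' : towers, refines S' S &
    forall i : index_of S', imbalance C D i = 0.
Proof.
move=> cC cD.
suff H K n (T : towers) : decides T C -> decides T D ->
    (forall i : index_of T, imbalance C D i <= K) ->
    #|[set i : index_of T | imbalance C D i == K]%SET| <= n ->
    fequidec alpha (indicator C) (indicator D) ->
    exists2 S' : towers, refines S' T &
      forall i : index_of S', imbalance C D i = 0.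
  move=> dC dD CD.
  apply: (H (\max_i imbalance C D i) _ S dC dD _ (leqnn _) CD) => i.
  exact: leq_bigmax.
elim: K n T => [|K ihK] n T.
  move=> _ _ leK _ _; exists T; first exact: refines_refl.
  by move=> i; apply/eqP; rewrite -leqn0.
elim: n T => [|n ihn] T dC dD leK cardK CD.
  apply: (ihK _ T dC dD _ (leqnn _) CD) => i.
  move: cardK; rewrite leqn0 cards_eq0 => /eqP/setP/(_ i).
  by rewrite !inE; have := leK i; lia.
have [i0 /eqP hi0|no] := pickP (fun i : index_of T => imbalance C D i == K.+1); last first.
  apply: (ihK _ T dC dD _ (leqnn _) CD) => i.
  by have := leK i; have := no i; lia.
have [S' [r leK' card']] : exists S' : towers, [/\ refines S' T,
    forall i : index_of S', imbalance C D i <= K.+1 &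
    #|[set i : index_of S' | imbalance C D i == K.+1]%SET| <
    #|[set i : index_of T | imbalance C D i == K.+1]%SET|].
  have [lt|ge] := ltnP (level_count alpha (base i0) D (levels i0))
                       (level_count alpha (base i0) C (levels i0)).
    by apply: (balance_step (i0 := i0)) => //; move: hi0; rewrite /imbalance; lia.
  (* When the extremal tower has an excess of [D]-levels, the roles of [C] and [D] are exchanged. *)
  have [i|||S' [r leK' card']] := balance_step (i0 := i0) (K := K.+1) cD cC dD dC (fequidec_sym actA CD).
  - by rewrite imbalanceC.
  - by [].
  - by move: hi0; rewrite /imbalance; lia.
  exists S'; split=> // [i|]; first by rewrite imbalanceC.
  congr (_ < _) : card'; apply: eq_card => i; rewrite !inE imbalanceC //.
have [|||S'' r' b] := ihn S' _ _ leK' _ CD.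
- exact: refines_decides r dC.
- exact: refines_decides r dD.
- by rewrite -ltnS; exact: leq_trans card' cardK.
by exists S'' => //; exact: refines_trans r' r.
Qed.

Lemma refine_pair (S : towers) C D : clopen C -> clopen D ->
  exists S' : towers, [/\ refines S' S, decides S' C &
    fequidec alpha (indicator C) (indicator D) ->
    exists2 h, tower_group S' h & forall x, C x <-> D (h x)].
Proof.
move=> cC cD.
have [S1 r1 d1C] := refine_decides actA S cC.
have [S2 r2 d2D] := refine_decides actA S1 cD.
have d2C := refines_decides actA r2 d1C.
have r20 := refines_trans actA r2 r1.
have [CD|nCD] := pselect (fequidec alpha (indicator C) (indicator D)); last by exists S2.
have [S3 r3 b3] := balance cC cD d2C d2D CD.
have d3C := refines_decides actA r3 d2C; have d3D := refines_decides actA r3 d2D.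
exists S3; split=> //; first exact: (refines_trans actA r3 r20).
by move=> _; exact: balanced_tower_group.
Qed.

(** * Construction of the dense ample subgroup *)

Hypothesis clopens : countable (@clopen X).

Lemma clopen_enumeration :
  exists e : nat -> set X, (forall n, clopen (e n)) /\
    forall A, clopen A -> exists n, e n = A.
Proof.
have /countable_injP[f finj] := clopens.
pose e n := xget set0 [set A | clopen A /\ f A = n].
exists e; split=> [n|A cA].
  by rewrite /e; case: xgetP => [B -> []//|_]; exact: clopen0.
exists (f A); rewrite /e; case: xgetP => [B _ [cB fB]|/(_ A)[]//].
by apply: finj => //; rewrite inE.
Qed.

Lemma tower_sequence : exists S : nat -> towers,
  (forall n, refines (S n.+1) (S n)) /\
  forall C D, clopen C -> clopen D -> exists n, decides (S n) C /\
    (fequidec alpha (indicator C) (indicator D) ->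
     exists2 h, tower_group (S n) h & forall x, C x <-> D (h x)).
Proof.
have [e [ce esurj]] := clopen_enumeration.
(* Stage [n.+1] treats the pair of clopen sets coded by [n]; a number coding no pair defaults to
   [(0, 0)]. *)
pose pr n := odflt (0, 0) (unpickle n : option (nat * nat)).
have /choice[step hstep] (q : nat * towers) := refine_pair q.2
  (ce (pr q.1).1) (ce (pr q.1).2).
pose S := fix S n := if n is m.+1 then step (m, S m) else trivial_towers alpha.
exists S; split=> [n|C D cC cD]; first by have [] := hstep (n, S n).
have [a <-] := esurj C cC; have [b <-] := esurj D cD.
exists (pickle (a, b)).+1; have [_] := hstep (pickle (a, b), S (pickle (a, b))).
by rewrite /pr /= pickleK.
Qed.

Lemma dense_ample_subgroup : exists H, [/\ H `<=` full_group alpha, ample H &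
  dense_in H (full_group alpha)].
Proof.
have [S [rS hS]] := tower_sequence.
have rmn m n : m <= n -> refines (S n) (S m).
  elim: n => [|n ih]; first by rewrite leqn0 => /eqP->; exact: refines_refl.
  rewrite leq_eqVlt => /orP[/eqP->|]; first exact: refines_refl.
  by rewrite ltnS => /ih; exact: refines_trans.
pose G n := tower_group (S n); pose H := \bigcup_n G n.
have Gmn m n : m <= n -> G m `<=` G n by move=> /rmn; exact: refines_tower_group.
have dmn m n C : m <= n -> decides (S m) C -> decides (S n) C.
  by move=> /rmn; exact: refines_decides.
have dS C : clopen C -> exists n, decides (S n) C.
  by move=> cC; have [n []] := hS C C cC cC; exists n.
have HG (I : finType) (g : I -> X -> X) : (forall i, H (g i)) ->
    exists n, forall i, G n (g i).
  move=> Hg; have /choice[m hm] i : exists m, G m (g i) by have [m _] := Hg i; exists m.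
  by exists (\max_i m i) => i; exact: (Gmn _ _ (leq_bigmax i)).
have Hhomeo : H `<=` homeo by move=> h [n _ []].
have Hgroup : is_subgroup H.
  split=> //.
  - by exists 0 => //; have [] := tower_group_subgroup (S 0).
  - move=> f g [m _ fm] [n _ gn]; exists (maxn m n) => //.
    have [_ _ + _] := tower_group_subgroup (S (maxn m n)); apply.
      exact: Gmn (leq_maxl m n) _ fm.
    exact: Gmn (leq_maxr m n) _ gn.
  - move=> f [n _ fn]; have [_ _ _ /(_ f fn)[f' [f'n fK f'K]]] := tower_group_subgroup (S n).
    by exists f'; split=> //; exists n.
(* One stage contains all the [g i] and decides all the pieces, so [tower_group_glue] applies at
   that stage. *)
have Hfull : full H.
  move=> h hh [n [A [g [/clopen_partitionP pA Hg hA]]]].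
  have [m gm] := HG _ _ Hg.
  have /choice[k hk] i := dS _ (pA.1 i).
  exists (maxn m (\max_i k i)) => //.
  apply: (tower_group_glue hh pA (g := g)) => // i.
    by apply: dmn (hk i); rewrite (leq_trans (leq_bigmax i)) // leq_maxr.
  exact: Gmn (leq_maxl _ _) _ (gm i).
have Hsub : H `<=` full_group alpha by move=> h [n _]; exact: tower_group_full.
exists H; split=> //.
  split=> //.
  - apply: bigcup_countable => // n _; apply: finite_set_countable.
    exact: tower_group_finite.
  - split=> // F finF FH.
    have /finite_seqP[s es] := finF.
    have [i|n hn] := HG _ (fun i : 'I_(size s) => nth (id : X -> X) s i).
      by apply: FH; rewrite es; exact: mem_nth.
    apply: sub_finite_set (tower_group_finite actA (S n)).
    apply: gen_subgroup_sub; first exact: tower_group_subgroup.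
    rewrite es => f /= fs; have fi : index f s < size s by rewrite index_mem.
    by have := hn (Ordinal fi); rewrite /= nth_index.
  - by move=> g [n _]; exact: tower_group_fixed.
move=> g gg n A /clopen_partitionP pA.
have [[cg [g' [cg' gK g'K]]] _] := gg.
have cgA i : clopen [set x | A i (g' x)] by exact: (preimage_clopen (pA.1 i) cg').
(* [A i] and its image under [g] are equidecomposable, so some element of [H] maps one onto the
   other; these elements are then glued, and fullness keeps the result in [H]. *)
have hA i : exists h, H h /\ forall x, A i x <-> A i (g' (h x)).
  have [m [_]] := hS _ _ (pA.1 i) (cgA i).
  case; last by move=> h hm hA; exists h; split=> //; exists m.
  exact: (fequidec_piecewise actA gg gK g'K (bounded_lc_indicator (pA.1 i))).
have /choice[h hh] := hA.
have hhomeo i := Hhomeo _ (hh i).1.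
have /choice[h' hh'] i : exists h' : X -> X,
    [/\ continuous h', cancel (h i) h' & cancel h' (h i)].
  by have [_ [h' ?]] := hhomeo i; exists h'.
have [|||||k [kh kA]] := @homeo_glue _ _ A h h' pA.
- by move=> i; exact: (hhomeo i).1.
- by move=> i; case: (hh' i).
- by move=> i; case: (hh' i).
- by move=> i; case: (hh' i).
- move=> x; rewrite -[RHS](pA.2 (g' x)); apply: eq_bigr => i _.
  apply: eq_indicator; have [_ _ h'K] := hh' i.
  by rewrite (hh i).2 h'K.
exists k; split.
  apply: Hfull => //; exists n, A, h; split=> //; first exact/clopen_partitionP.
  by move=> i; exact: (hh i).1.
move=> i; have [_ hK h'K] := hh' i; apply/seteqP; split=> y [x Ax <-].
  rewrite (kA i) //; exists (g' (h i x)); first exact: (iffLR ((hh i).2 x) Ax).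
  by rewrite g'K.
have Ah : A i (h' i (g x)) by apply/(hh i).2; rewrite h'K gK.
by exists (h' i (g x)); rewrite ?(kA i) ?h'K.
Qed.

End Balancing.

(** * Countability of the clopen sets and the equivalence *)

Lemma compact_countable_clopen (R : realType) (X : pseudoMetricType R) :
  compact [set: X] -> countable (@clopen X).
Proof.
move=> cX; have [[x0 _]|nX] := pselect (exists x : X, True).
  (* A point [x0] makes [X] a pointed space, as second countability is used in that form; if there
     is no point, the empty set is the only clopen set. *)
  pose Y := HB.pack_for (pseudoPMetricType R) X (isPointed.Build X x0).
  exact: (@clopen_countable Y cX (@compact_second_countable R Y cX)).
apply: (@sub_countable _ _ _ [set (set0 : set X)]); last exact: countable1.
apply: subset_card_le => A _; apply/seteqP; split=> x // _.
by apply: nX; exists x.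
Qed.

Theorem theoremp (R : realType) (X : pseudoMetricType R) (Gam : groupType)
    (alpha : Gam -> X -> X) :
  compact [set: X] -> hausdorff_space X -> zero_dimensional X ->
  countable [set: Gam] -> is_action alpha ->
  ((exists H, [/\ is_subgroup H, H `<=` full_group alpha, locally_finite H &
                 dense_in H (full_group alpha)]) <->
   (exists H, [/\ H `<=` full_group alpha, ample H &
                 dense_in H (full_group alpha)])) /\
  ((exists H, [/\ H `<=` full_group alpha, ample H &
                 dense_in H (full_group alpha)]) <->
   (T_unperforated alpha /\ T_cancellative alpha)).
Proof.
move=> cX _ _ _ actA.
have i_iii : (exists H, [/\ is_subgroup H, H `<=` full_group alpha,
      locally_finite H & dense_in H (full_group alpha)]) ->
    T_unperforated alpha /\ T_cancellative alpha.
  move=> [H [gH fH lH dH]]; split.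
    apply/(T_unperforatedP actA).
    exact: (dense_locally_finite_unperforated actA gH fH lH dH).
  apply/(T_cancellativeP actA).
  exact: (dense_locally_finite_cancellative actA gH fH lH dH).
have iii_ii : T_unperforated alpha /\ T_cancellative alpha ->
    exists H, [/\ H `<=` full_group alpha, ample H &
                 dense_in H (full_group alpha)].
  move=> [/(T_unperforatedP actA) up /(T_cancellativeP actA) cc].
  exact: (dense_ample_subgroup actA cc up (compact_countable_clopen cX)).
have ii_i : (exists H, [/\ H `<=` full_group alpha, ample H &
      dense_in H (full_group alpha)]) ->
    exists H, [/\ is_subgroup H, H `<=` full_group alpha, locally_finite H &
                 dense_in H (full_group alpha)].
  by move=> [H [fH [gH _ lH _ _] dH]]; exists H.
by split; split; [move=> /i_iii/iii_ii|move=> /ii_i|move=> /ii_i/i_iii|].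
Qed.
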